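(* Assume that the function $f:(0,\infty)\to\mathbb{R}$ is operator monotone in $(0,\infty)$ and has the representation $$f(t)=a+bt+\int_0^\infty \frac{t\lambda}{t+\lambda}\,dw(\lambda),\qquad t>0,$$ where $a\in\mathbb{R}$, $b\ge 0$ and $w$ is a positive measure on $(0,\infty)$ such that $\int_0^\infty \frac{\lambda}{1+\lambda}\,dw(\lambda)<\infty$. Then for all $A,B,P>0$ we have $$\mathcal{P}_f(B,P)-\mathcal{P}_f(A,P)=b(B-A)+\int_0^\infty \lambda^2\left[\int_0^1 P\big((1-t)A+tB+\lambda P\big)^{-1}(B-A)\big((1-t)A+tB+\lambda P\big)^{-1}P\,dt\right]dw(\lambda).$$
   Context: All operators are bounded linear operators on a complex Hilbert space $H$. $T\ge 0$ means $\langle Tx,x\rangle\ge 0$ for all $x\in H$; $T\ge S$ means $T-S\ge 0$ (for selfadjoint $T,S$); $T>0$ means $T\ge 0$ and $T$ is invertible. A real-valued continuous function $f$ on $(0,\infty)$ is operator monotone if $f(A)\ge f(B)$ whenever $A\ge B>0$ (with $f(A)$ given by the continuous functional calculus). For $f:(0,\infty)\to\mathbb{R}$ continuous and $A,B>0$, the perspective is $\mathcal{P}_f(B,A):=A^{1/2}f\left(A^{-1/2}BA^{-1/2}\right)A^{1/2}$. Integrals of operator-valued functions are Bochner integrals; the outer integral is over $(0,\infty)$. *)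

(* Defs.v *)
From HB Require Import structures.
From mathcomp Require Import all_boot all_order all_algebra.
From mathcomp Require Import all_classical all_reals all_analysis.
From mathcomp Require Import complex.

Set Implicit Arguments.
Unset Strict Implicit.
Unset Printing Implicit Defensive.
Import Order.TTheory GRing.Theory Num.Theory.
Import numFieldNormedType.Exports.
Local Open Scope classical_set_scope.
Local Open Scope ring_scope.
Local Open Scope complex_scope.

(* Norms of complex normed spaces take their values in R[i]; [rnorm] is the same
   norm, valued in R. *)
Definition rnorm (R : realType) (V : normedZmodType R[i]) (x : V) : R :=
  complex.Re `|x|.

Lemma rnormE (R : realType) (V : normedZmodType R[i]) (x : V) :
  (rnorm x)%:C = `|x|.
Proof. by rewrite RRe_real// normr_real. Qed.

(* The inner product is linear in its first argument; positive definiteness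
   follows from [innerxx]. *)
HB.mixin Record NormedModule_isHilbert (R : realType) H
    & CompleteNormedModule R[i] H := {
  inner : H -> H -> R[i];
  innerPl : forall (a : R[i]) (x y z : H),
    inner (a *: x + y) z = a * inner x z + inner y z;
  innerC : forall x y : H, inner y x = Num.conj (inner x y);
  innerxx : forall x : H, inner x x = `|x| ^+ 2
}.

#[short(type="hilbertType")]
HB.structure Definition Hilbert (R : realType) :=
  {H of CompleteNormedModule R[i] H & NormedModule_isHilbert R H}.



Section BoundedOperators.
Context {R : realType} {H : hilbertType R}.

Definition op_bounded (T : H -> H) :=
  exists M : R, forall x, rnorm (T x) <= M * rnorm x.

Record bounded_op := BoundedOp {
  op_fun :> {linear H -> H};
  op_funP : op_bounded op_fun
}.

(* [bounded_op] is made into the normed complex algebra B(H): the ring product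
   is composition and the norm is the operator norm. The ring is only a
   [pzRingType] because H may be the zero space. *)

HB.instance Definition _ := gen_eqMixin bounded_op.
HB.instance Definition _ := gen_choiceMixin bounded_op.

Implicit Types S T U : bounded_op.

Lemma rnorm_ge0 (x : H) : 0 <= rnorm x.
Proof. by rewrite -lecR rnormE normr_ge0. Qed.

Lemma rnorm0 : rnorm (0 : H) = 0.
Proof. by rewrite /rnorm normr0. Qed.

Lemma rnormD (x y : H) : rnorm (x + y) <= rnorm x + rnorm y.
Proof. by rewrite -lecR rmorphD/= !rnormE ler_normD. Qed.

Lemma rnormZ (a : R[i]) (x : H) : rnorm (a *: x) = rnorm a * rnorm x.
Proof. by apply: complexI; rewrite rmorphM/= !rnormE normrZ. Qed.

Lemma bounded_opP S T : (forall x, S x = T x) -> S = T.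
Proof.
case: S T => [[f cf] bf] [[g cg] bg] /= fg.
have E : f = g by apply/funext.
rewrite -{g}E in cg bg fg *.
have -> : cg = cf.
  case: cg {bg} => [[d1] [z1]]; case: cf {bf} => [[d2] [z2]].
  by congr GRing.Linear.Class; congr (_ _); exact: Prop_irrelevance.
by congr BoundedOp; exact: Prop_irrelevance.
Qed.

Lemma op_bounded0 : op_bounded (\0 : H -> H).
Proof. by exists 0 => x; rewrite /= rnorm0 mul0r. Qed.

Lemma op_boundedN T : op_bounded (\- T).
Proof. have [M TM] := op_funP T; exists M => x; rewrite /= /rnorm normrN; exact: TM. Qed.

Lemma op_boundedD S T : op_bounded (S \+ T).
Proof.
have [M SM] := op_funP S; have [N TN] := op_funP T; exists (M + N) => x /=.
by rewrite mulrDl (le_trans (rnormD _ _))// lerD.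
Qed.

Lemma op_boundedZ (a : R[i]) T : op_bounded (a \*: T).
Proof.
have [M TM] := op_funP T; exists (rnorm a * M) => x /=.
by rewrite rnormZ -mulrA ler_wpM2l// -lecR rnormE normr_ge0.
Qed.

Lemma op_bounded1 : op_bounded (idfun : H -> H).
Proof. by exists 1 => x; rewrite mul1r. Qed.

Lemma op_boundedM S T : op_bounded (S \o T).
Proof.
have [M SM] := op_funP S; have [N TN] := op_funP T.
exists (`|M| * N) => x /=; rewrite -mulrA (le_trans (SM _))//.
rewrite (@le_trans _ _ (`|M| * rnorm (T x)))//.
  by rewrite ler_wpM2r// ?rnorm_ge0// ler_norm.
by rewrite ler_wpM2l.
Qed.

Definition op_zero := BoundedOp op_bounded0.
Definition op_opp T := BoundedOp (op_boundedN T).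
Definition op_add S T := BoundedOp (op_boundedD S T).
Definition op_scale a T := BoundedOp (op_boundedZ a T).
Definition op_one := BoundedOp op_bounded1.
Definition op_mul S T := BoundedOp (op_boundedM S T).

Lemma op_addA : associative op_add.
Proof. by move=> S T U; apply: bounded_opP => x /=; rewrite addrA. Qed.

Lemma op_addC : commutative op_add.
Proof. by move=> S T; apply: bounded_opP => x /=; rewrite addrC. Qed.

Lemma op_add0 : left_id op_zero op_add.
Proof. by move=> T; apply: bounded_opP => x /=; rewrite add0r. Qed.

Lemma op_addN : left_inverse op_zero op_opp op_add.
Proof. by move=> T; apply: bounded_opP => x /=; rewrite addNr. Qed.

HB.instance Definition _ :=
  GRing.isZmodule.Build bounded_op op_addA op_addC op_add0 op_addN.

Lemma op_mulA : associative op_mul.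
Proof. by move=> S T U; apply: bounded_opP. Qed.

Lemma op_mul1 : left_id op_one op_mul.
Proof. by move=> T; apply: bounded_opP. Qed.

Lemma op_mulr1 : right_id op_one op_mul.
Proof. by move=> T; apply: bounded_opP. Qed.

Lemma op_mulDl : left_distributive op_mul +%R.
Proof. by move=> S T U; apply: bounded_opP. Qed.

Lemma op_mulDr : right_distributive op_mul +%R.
Proof. by move=> S T U; apply: bounded_opP => x /=; rewrite linearD. Qed.

HB.instance Definition _ := GRing.Zmodule_isPzRing.Build bounded_op
  op_mulA op_mul1 op_mulr1 op_mulDl op_mulDr.

Lemma op_scaleA a b T : op_scale a (op_scale b T) = op_scale (a * b) T.
Proof. by apply: bounded_opP => x /=; rewrite scalerA. Qed.

Lemma op_scale1 : left_id 1 op_scale.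
Proof. by move=> T; apply: bounded_opP => x /=; rewrite scale1r. Qed.

Lemma op_scaleDr : right_distributive op_scale +%R.
Proof. by move=> a S T; apply: bounded_opP => x /=; rewrite scalerDr. Qed.

Lemma op_scaleDl T : {morph op_scale^~ T : a b / a + b}.
Proof. by move=> a b; apply: bounded_opP => x /=; rewrite scalerDl. Qed.

HB.instance Definition _ := GRing.Zmodule_isLmodule.Build R[i] bounded_op
  op_scaleA op_scale1 op_scaleDr op_scaleDl.

Definition opnorm T : R := sup [set rnorm (T x) | x in [set x : H | rnorm x <= 1]].

Lemma opnorm_has_sup T :
  has_sup [set rnorm (T x) | x in [set x : H | rnorm x <= 1]].
Proof.
have [M TM] := op_funP T; split.
  by exists (rnorm (T 0)), 0; rewrite //= rnorm0.
exists `|M| => _ [x /= x1 <-]; rewrite (le_trans (TM x))//.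
rewrite (@le_trans _ _ (`|M| * rnorm x))//.
  by rewrite ler_wpM2r ?rnorm_ge0 ?ler_norm.
by rewrite ler_piMr.
Qed.

Lemma opnorm_ub T x : rnorm x <= 1 -> rnorm (T x) <= opnorm T.
Proof.
by move=> x1; apply: ub_le_sup; [case: (opnorm_has_sup T)|exists x].
Qed.

Lemma opnorm_le T (M : R) :
  (forall x, rnorm x <= 1 -> rnorm (T x) <= M) -> opnorm T <= M.
Proof.
move=> TM; apply: ge_sup; first by case: (opnorm_has_sup T).
by move=> _ [x /= x1 <-]; exact: TM.
Qed.

Lemma opnorm_ge0 T : 0 <= opnorm T.
Proof.
rewrite (le_trans (rnorm_ge0 (T 0)))// opnorm_ub//.
by rewrite rnorm0.
Qed.

Lemma opnorm_bound T x : rnorm (T x) <= opnorm T * rnorm x.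
Proof.
have [->|x0] := eqVneq x 0; first by rewrite linear0 rnorm0 mulr0.
have nx : 0 < rnorm x by rewrite -ltcR rnormE normr_gt0.
have rV : rnorm ((rnorm x)^-1%:C : R[i]) = (rnorm x)^-1.
  by apply: complexI; rewrite rnormE ger0_norm// lecR invr_ge0 ltW.
rewrite -ler_pdivrMr// mulrC -rV -rnormZ -linearZ opnorm_ub//.
by rewrite rnormZ rV mulVf ?gt_eqF.
Qed.

Lemma opnormD S T : (opnorm (S + T))%:C <= (opnorm S)%:C + (opnorm T)%:C.
Proof.
rewrite -rmorphD/= lecR; apply: opnorm_le => x x1.
by rewrite (le_trans (rnormD _ _))// lerD// opnorm_ub.
Qed.

Lemma opnormZ (a : R[i]) T : (opnorm (a *: T))%:C = `|a| * (opnorm T)%:C.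
Proof.
have a0 : 0 <= rnorm a by rewrite -lecR rnormE normr_ge0.
rewrite -rnormE -rmorphM/=; congr _%:C; apply/eqP; rewrite eq_le; apply/andP; split.
  by apply: opnorm_le => x x1; rewrite rnormZ ler_wpM2l// opnorm_ub.
have [->|na0] := eqVneq (rnorm a) 0; first by rewrite mul0r opnorm_ge0.
have {na0}a0 : 0 < rnorm a by rewrite lt_def na0.
rewrite mulrC -ler_pdivlMr//; apply: opnorm_le => x x1.
by rewrite ler_pdivlMr// mulrC -rnormZ; exact: (@opnorm_ub (a *: T)).
Qed.

Lemma opnorm0_eq0 T : (opnorm T)%:C = 0 -> T = 0.
Proof.
move=> /(@complexI _ _ 0) T0; apply: bounded_opP => x.
apply/eqP; rewrite -normr_eq0 -rnormE; apply/eqP; congr _%:C.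
by apply/eqP; rewrite eq_le rnorm_ge0 andbT (le_trans (opnorm_bound _ _))// T0 mul0r.
Qed.

HB.instance Definition _ := @Lmodule_isNormed.Build R[i] bounded_op
  (fun T => (opnorm T)%:C) opnormD opnormZ opnorm0_eq0.

End BoundedOperators.
Arguments bounded_op {R} H.

Section FunctionalCalculus.
Context {R : realType} {H : hilbertType R}.
Implicit Types (S T A B : bounded_op H) (f : R -> R).

Definition op_inverse T := [set S | S * T = 1 /\ T * S = 1].

Definition op_invertible T := exists S, op_inverse T S.

(* The inverse of T, and 0 when T is not invertible. *)
Definition op_inv T : bounded_op H := xget 0 (op_inverse T).

(* The order of R[i] makes [0 <= z] say that z is real and nonnegative. *)
Definition op_nneg T := forall x : H, 0 <= inner (T x) x.

Definition op_le S T := op_nneg (T - S).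

Definition op_pos T := op_nneg T /\ op_invertible T.

Definition spectrum T : set R[i] :=
  [set z : R[i] | ~ op_invertible (T - z *: (1 : bounded_op H))].

Definition op_horner (p : {poly R}) T : bounded_op H :=
  \sum_(i < size p) (p`_i)%:C *: T ^+ i.

(* Continuous functional calculus of a selfadjoint T (whose spectrum is real):
   f(T) is the norm limit of p_n(T) for real polynomials p_n converging to f
   uniformly on the spectrum of T. *)
Definition is_cfc f T S := exists p : nat -> {poly R},
  (forall e : R, 0 < e -> \forall n \near \oo,
     forall t : R, spectrum T t%:C -> `|(p n).[t] - f t| <= e) /\
  op_horner (p n) T @[n --> \oo] --> S.

Definition cfc f T : bounded_op H := xget 0 [set S | is_cfc f T S].

Definition op_pow (r : R) T := cfc (fun t => t `^ r) T.

Definition perspective f B A : bounded_op H :=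
  op_pow 2^-1 A * cfc f (op_pow (- 2^-1) A * B * op_pow (- 2^-1) A)
    * op_pow 2^-1 A.

End FunctionalCalculus.

Definition operator_monotone (R : realType) (H : hilbertType R) (f : R -> R) :=
  {within `]0, +oo[, continuous f} /\
  forall A B : bounded_op H, op_pos B -> op_le B A -> op_le (cfc f B) (cfc f A).

Section Bochner.
Context {R : realType} {V : normedModType R[i]} {d : measure_display}
  {T : measurableType d}.
Variables (mu : {measure set T -> \bar R}) (D : set T).
Implicit Types s g : T -> V.

Definition bochner_simple s :=
  [/\ finite_set (range s), forall v, measurable (s @^-1` [set v]) &
      forall v, v != 0 -> (mu (D `&` s @^-1` [set v]) < +oo)%E].

Definition simple_integral s : V :=
  \sum_(v \in range s) (fine (mu (D `&` s @^-1` [set v])))%:C *: v.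

(* The functions [g - s_ n] are limits almost everywhere of measurable
   functions; when mu is not complete they may fail to be measurable, but the
   integral of a nonnegative function, a supremum over simple functions, is
   insensitive to changes on negligible sets. *)
Definition is_bochner g (v : V) := exists s_ : nat -> T -> V,
  [/\ forall n, bochner_simple (s_ n),
      {ae mu, forall x, D x -> s_ n x @[n --> \oo] --> g x},
      (\int[mu]_(x in D) (rnorm (g x - s_ n x))%:E)%E @[n --> \oo] --> 0%E &
      simple_integral (s_ n) @[n --> \oo] --> v].

Definition bochner_integrable g := exists v, is_bochner g v.

(* Equal to 0 when g is not Bochner integrable. *)
Definition bochner g : V := xget 0 (is_bochner g).

End Bochner.

(* Main.v *)
From HB Require Import structures.
Require Import Defs.
From mathcomp Require Import all_boot all_order all_algebra.
From mathcomp Require Import all_classical all_reals all_analysis.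
From mathcomp Require Import measurable_realfun complex finmap ring lra.
Import Order.TTheory GRing.Theory Num.Theory.
Import numFieldNormedType.Exports.
Set Implicit Arguments.
Unset Strict Implicit.
Unset Printing Implicit Defensive.
Local Open Scope classical_set_scope.
Local Open Scope ring_scope.
Local Open Scope complex_scope.

(** Write [S] for the square root of [P] and [C X] for [S^-1 X S^-1], so that the
    perspective of [f] at [X] and [P] is [S f(C X) S].

    The integrand of the representation is [h_l(t) = t l / (t + l) = l - l^2 / (t + l)].
    Since [C X + l = S^-1 (X + l P) S^-1], sandwiching gives
    [S h_l(C X) S = l P - l^2 P (X + l P)^-1 P] ([kernel_sandwich]), and the
    difference between [X = B] and [X = A] is
    [l^2 (P (A + l P)^-1 P - P (B + l P)^-1 P)]. By the resolvent identity,
    [- P X(t)^-1 P] with [X(t) = (1 - t) A + t B + l P] is a primitive of the inner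
    integrand, so this difference is [l^2] times the inner integral
    ([bochner_segment]). The affine part [a + b t] of [f] contributes
    [b (B - A)], and what remains is to exchange the functional calculus with the
    integral over [l] ([repr_sum_cvg], [bochner_kernel_difference]).

    That exchange is done on sums. For [0 < t <= N] the kernel satisfies
    [|h_l(t) - h_l'(t)| <= max(1, N) (l - l') / (1 + l)] when [0 <= l' <= l]
    ([kernel_lipschitz]). Replacing [l] by the value [d_n(l) <= l] of a
    finite-valued approximation of the identity thus costs at most the integral of
    [max(1, N) (l - d_n(l)) / (1 + l)], uniformly in [t]; this tends to [0] by
    dominated convergence, because [l / (1 + l)] is integrable. As the functional
    calculus of a selfadjoint operator does not increase norms ([spectral_bound],
    [is_cfc_dist]), the same estimate holds in operator norm, once for the
    approximation of [f(C X)] by finite sums of the [h_l(C X)], and once for the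
    approximation of the outer integrand by simple functions.

    The functional calculus rests on the bound of [|p(T)|] by the supremum of [|p|]
    on the spectrum of [T], on the completeness of the operator norm, and on explicit
    polynomial approximations of [t^(-1/2)], from which those of [t^(1/2)] and of
    [(t + l)^-1] follow. Bochner integrals are compared with the scalar integrals of
    the functions [Re <g x, y>]: for a function that is approximated everywhere by
    simple functions, these determine the integral ([is_bochnerP]). This gives
    uniqueness, and it reduces the inner integral to the fundamental theorem of
    calculus for real functions. *)

(** * Norms and the real inner product *)

Section RealNorm.
Context {R : realType} {V : normedZmodType R[i]}.
Implicit Types x y : V.

Lemma rnorm_nneg x : 0 <= rnorm x.
Proof. by rewrite -lecR rnormE normr_ge0. Qed.

Lemma rnorm_add x y : rnorm (x + y) <= rnorm x + rnorm y.
Proof. by rewrite -lecR rmorphD/= !rnormE ler_normD. Qed.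

Lemma rnorm_opp x : rnorm (- x) = rnorm x.
Proof. by rewrite /rnorm normrN. Qed.

Lemma rnorm_sub x y : rnorm (x - y) = rnorm (y - x).
Proof. by rewrite -rnorm_opp opprB. Qed.

Lemma rnorm_zero : rnorm (0 : V) = 0.
Proof. by rewrite /rnorm normr0. Qed.

Lemma rnorm_eq0P x : rnorm x = 0 -> x = 0.
Proof. by move=> x0; apply/eqP; rewrite -normr_eq0 -rnormE x0. Qed.

End RealNorm.

Section RealNormConvergence.
Context {R : realType} {V : normedModType R[i]}.

Lemma rnorm_scale (a : R) (x : V) : rnorm (a%:C *: x) = `|a| * rnorm x.
Proof.
apply: complexI; rewrite rmorphM /= !rnormE normrZ; congr (_ * _).
by rewrite normc_def /= expr0n addr0 sqrtr_sqr.
Qed.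

(** Convergence in a complex normed space is stated with balls of radius in [R[i]];
    this form has real radii. *)
Lemma cvg_rnormP (u : nat -> V) (v : V) :
  (u n @[n --> \oo] --> v) <->
  (forall e : R, 0 < e -> \forall n \near \oo, rnorm (v - u n) < e).
Proof.
split=> [/cvgrPdist_lt uv e e0|uv].
  have : 0 < e%:C by rewrite ltcR.
  by move=> /uv; apply: filterS => n; rewrite -rnormE ltcR.
apply/cvgrPdist_lt => -[e e']; rewrite ltcE /= => /andP[/eqP -> e0].
by apply: filterS (uv _ e0) => n; rewrite -rnormE -[e +i* 0]/(e%:C) ltcR.
Qed.

Lemma cvg_rnorm0 (u : nat -> V) (v : V) :
  (u n @[n --> \oo] --> v) <-> (rnorm (v - u n) @[n --> \oo] --> (0 : R)).
Proof.
split=> [/cvg_rnormP uv|uv].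
  apply/cvgrPdist_lt => e e0; apply: filterS (uv e e0) => n.
  by rewrite sub0r normrN ger0_norm ?rnorm_nneg.
apply/cvg_rnormP => e e0; move/cvgrPdist_lt: uv => /(_ e e0); apply: filterS => n.
by rewrite sub0r normrN ger0_norm ?rnorm_nneg.
Qed.

Lemma seq_cvg_unique (u : nat -> V) (v v' : V) :
  u n @[n --> \oo] --> v -> u n @[n --> \oo] --> v' -> v = v'.
Proof. exact: (norm_cvg_unique (F := u n @[n --> \oo])). Qed.

End RealNormConvergence.

Section RealInnerProduct.
Context {R : realType} {H : hilbertType R}.
Implicit Types (x y z : H) (S T : bounded_op H).

(** For the real part of the inner product, [H] is a real inner product space with
    the same norm; symmetry of an operator and its form inequalities then only involve
    real numbers. *)
Definition rip x y : R := complex.Re (inner x y).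

Lemma innerDl x y z : inner (x + y) z = inner x z + inner y z.
Proof. by rewrite -[x in LHS]scale1r innerPl mul1r. Qed.

Lemma inner0l z : inner 0 z = 0 :> R[i].
Proof. by apply: (addIr (inner 0 z)); rewrite -innerDl !add0r. Qed.

Lemma innerZl (a : R[i]) x z : inner (a *: x) z = a * inner x z.
Proof. by rewrite -[a *: x]addr0 innerPl inner0l addr0. Qed.

Lemma ripC x y : rip x y = rip y x.
Proof. by rewrite /rip innerC; case: (inner y x). Qed.

Lemma ripDl x y z : rip (x + y) z = rip x z + rip y z.
Proof. by rewrite /rip innerDl raddfD. Qed.

Lemma ripZl (a : R) x z : rip (a%:C *: x) z = a * rip x z.
Proof. by rewrite /rip innerZl; case: (inner x z) => u v /=; rewrite mul0r subr0. Qed.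

Lemma ripNl x z : rip (- x) z = - rip x z.
Proof. by rewrite -scaleN1r -[-1](rmorphN1 (real_complex R)) ripZl mulN1r. Qed.

Lemma ripBl x y z : rip (x - y) z = rip x z - rip y z.
Proof. by rewrite ripDl ripNl. Qed.

Lemma rip0l z : rip 0 z = 0.
Proof. by rewrite /rip inner0l. Qed.

Lemma ripDr x y z : rip z (x + y) = rip z x + rip z y.
Proof. by rewrite ripC ripDl !(ripC z). Qed.

Lemma ripZr (a : R) x z : rip z (a%:C *: x) = a * rip z x.
Proof. by rewrite ripC ripZl (ripC z). Qed.

Lemma ripNr x z : rip z (- x) = - rip z x.
Proof. by rewrite ripC ripNl (ripC z). Qed.

Lemma ripxx x : rip x x = rnorm x ^+ 2.
Proof. by rewrite /rip innerxx -rnormE -rmorphXn. Qed.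

Definition op_sym T := forall x y, rip (T x) y = rip x (T y).

(** This is where the scalars have to be complex: a quadratic form with real
    values is hermitian, as one sees by expanding it at [x + i y]. *)
Lemma op_nneg_sym T : op_nneg T -> op_sym T.
Proof.
move=> T0 x y; have Im0 z : complex.Im (inner (T z) z) = 0.
  by have := T0 z; rewrite lecE => /andP[/eqP ->].
have := Im0 (x + 'i *: y).
rewrite linearD linearZ innerDl innerZl.
rewrite !(innerC (x + 'i *: y)) !innerDl !innerZl !rmorphD !rmorphM /=.
rewrite -!innerC.
have := Im0 x; have := Im0 y; rewrite [rip x _]ripC /rip.
rewrite [inner (T y) x]innerC.
case: (inner (T x) x) => a b; case: (inner (T y) y) => c d.
case: (inner x (T y)) => e f; case: (inner (T x) y) => g h /=.
lra.
Qed.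

Lemma op_nneg_rip T x : op_nneg T -> 0 <= rip (T x) x.
Proof. by move=> /(_ x); rewrite lecE => /andP[]. Qed.

(** The discriminant of the nonnegative polynomial [s |-> <T (x + s y), x + s y>]. *)
Lemma form_Cauchy_Schwarz T x y : op_sym T -> (forall z, 0 <= rip (T z) z) ->
  rip (T x) y ^+ 2 <= rip (T x) x * rip (T y) y.
Proof.
move=> sT T0.
have E (s : R) : 0 <= rip (T x) x + 2 * s * rip (T x) y + s ^+ 2 * rip (T y) y.
  have := T0 (x + s%:C *: y); rewrite linearD linearZ !ripDl !ripDr !ripZl !ripZr.
  by rewrite (sT y x) (ripC y); lra.
have := T0 y; rewrite le_eqVlt => /orP[/eqP y0|y0].
  rewrite -y0 mulr0; have [->|xy0] := eqVneq (rip (T x) y) 0; first by rewrite expr0n.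
  have := E (- (rip (T x) x + 1) / (2 * rip (T x) y)); rewrite -y0 mulr0 addr0.
  have -> : 2 * (- (rip (T x) x + 1) / (2 * rip (T x) y)) * rip (T x) y
    = - (rip (T x) x + 1) by field.
  lra.
have := E (- rip (T x) y / rip (T y) y).
have -> : rip (T x) x + 2 * (- rip (T x) y / rip (T y) y) * rip (T x) y
  + (- rip (T x) y / rip (T y) y) ^+ 2 * rip (T y) y =
  (rip (T x) x * rip (T y) y - rip (T x) y ^+ 2) / rip (T y) y.
  by field; rewrite gt_eqF.
by rewrite pmulr_lge0 ?invr_gt0// subr_ge0.
Qed.

Lemma rip_le x y : `|rip x y| <= rnorm x * rnorm y.
Proof.
rewrite -ler_sqr ?nnegrE ?mulr_ge0 ?rnorm_nneg// exprMn -!ripxx real_normK ?num_real//.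
by apply: (@form_Cauchy_Schwarz 1) => // z; rewrite ripxx sqr_ge0.
Qed.

Lemma rnorm_bound T x : rnorm (T x) <= rnorm T * rnorm x.
Proof. exact: opnorm_bound. Qed.

Lemma rip_op_le T x y : `|rip (T x) y| <= rnorm T * (rnorm x * rnorm y).
Proof.
by rewrite (le_trans (rip_le _ _))// mulrA ler_wpM2r ?rnorm_nneg ?rnorm_bound.
Qed.

Lemma rnorm_op_le T (M : R) : 0 <= M ->
  (forall x, rnorm (T x) <= M * rnorm x) -> rnorm T <= M.
Proof.
move=> M0 TM; apply: opnorm_le => x x1; apply: le_trans (TM x) _.
by rewrite ler_piMr.
Qed.

(** Take [y = T x]. *)
Lemma rnorm_op_rip T (M : R) : 0 <= M ->
  (forall x y, `|rip (T x) y| <= M * (rnorm x * rnorm y)) -> rnorm T <= M.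
Proof.
move=> M0 TM; apply: rnorm_op_le => // x.
have [->|Tx0] := eqVneq (rnorm (T x)) 0; first by rewrite mulr_ge0 ?rnorm_nneg.
have {}Tx0 : 0 < rnorm (T x) by rewrite lt_def Tx0 rnorm_nneg.
rewrite -(ler_pM2r Tx0) -expr2 -mulrA -ripxx.
by apply: le_trans (TM x (T x)); rewrite ler_norm.
Qed.

Lemma rnormM S T : rnorm (S * T) <= rnorm S * rnorm T.
Proof.
apply: rnorm_op_le => [|x]; first by rewrite mulr_ge0 ?rnorm_nneg.
rewrite (le_trans (rnorm_bound S (T x)))// -mulrA ler_wpM2l ?rnorm_nneg//.
exact: rnorm_bound.
Qed.

Lemma rnorm1 : rnorm (1 : bounded_op H) <= 1.
Proof. by apply: rnorm_op_le => // x; rewrite mul1r. Qed.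

Lemma op_eq_rip S T : (forall x y, rip (S x) y = rip (T x) y) -> S = T.
Proof.
move=> ST; apply: bounded_opP => x; apply/eqP; rewrite -subr_eq0; apply/eqP.
apply: rnorm_eq0P; apply/eqP; rewrite -sqrf_eq0 -ripxx.
by rewrite ripBl ST subrr.
Qed.

End RealInnerProduct.

(** * Operators: completeness, inverses, positivity *)

Section Completeness.
Context {R : realType}.

Lemma rcauchy_cvg (V : completeNormedModType R[i]) (u : nat -> V) :
  (forall e : R, 0 < e -> exists N, forall m n, (N <= m)%N -> (N <= n)%N ->
     rnorm (u m - u n) < e) ->
  exists v : V, u n @[n --> \oo] --> v.
Proof.
move=> uC; suff /cvg_ex[v uv] : cvgn u by exists v.
apply: cauchy_cvg; apply: cauchy_exP => -[e e']; rewrite ltcE /= => /andP[/eqP -> e0].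
have [N uN] := uC e e0; exists (u N); exists N => // n /= Nn.
by rewrite -ball_normE /= -[e +i* 0]/(e%:C) -rnormE ltcR uN.
Qed.

Context {H : hilbertType R}.
Implicit Types (S T : bounded_op H) (u v : nat -> bounded_op H).

(** A Cauchy sequence of operators converges at each vector, and the pointwise
    limit inherits linearity and the Cauchy estimates. *)
Lemma op_cauchy_cvg u :
  (forall e : R, 0 < e -> exists N, forall m n, (N <= m)%N -> (N <= n)%N ->
     rnorm (u m - u n) < e) ->
  exists T, u n @[n --> \oo] --> T.
Proof.
move=> uC.
have uxC x : exists y : H, u n x @[n --> \oo] --> y.
  apply: rcauchy_cvg => e e0.
  have x0 : 0 < rnorm x + 1 by rewrite ltr_wpDl ?rnorm_nneg.
  have [|N uN] := uC (e / (rnorm x + 1)); first exact: divr_gt0.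
  exists N => m n Nm Nn; apply: le_lt_trans (rnorm_bound (u m - u n) x) _.
  apply: (@le_lt_trans _ _ (rnorm (u m - u n) * (rnorm x + 1))).
    by rewrite ler_wpM2l ?rnorm_nneg// lerDl.
  by rewrite -ltr_pdivlMr// uN.
pose f x := projT1 (cid (uxC x)).
have fP x : u n x @[n --> \oo] --> f x by rewrite /f; case: cid.
have f_linear : linear f.
  move=> a x y; apply: (seq_cvg_unique (fP _)).
  have -> : (fun n => u n (a *: x + y)) = (fun n => a *: u n x + u n y).
    by apply/funext => n; rewrite linearP.
  by apply: cvgD; [apply: cvgZr|]; exact: fP.
pose fl : {linear H -> H} := HB.pack f (GRing.isLinear.Build _ _ _ _ f f_linear).
(* letting one index tend to infinity in the Cauchy estimate at [x] *)
have close (e : R) : 0 < e -> exists N, forall n, (N <= n)%N ->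
    forall x, rnorm (f x - u n x) <= e * rnorm x.
  move=> e0; have [N uN] := uC e e0; exists N => n Nn x.
  apply/ler_addgt0Pr => d d0.
  have /cvg_rnormP/(_ d d0)[M _ fM] := fP x.
  have /(_ (leq_maxl _ _)) fM' := fM (maxn M N).
  have -> : f x - u n x = (f x - u (maxn M N) x) + (u (maxn M N) - u n) x.
    by rewrite /= addrA subrK.
  rewrite (le_trans (rnorm_add _ _))// addrC lerD//; last exact: ltW.
  rewrite (le_trans (rnorm_bound _ _))// ler_wpM2r ?rnorm_nneg// ltW// uN//.
  exact: leq_maxr.
have f_bounded : op_bounded fl.
  have [N fN] := close 1 ltr01; exists (1 + rnorm (u N)) => x.
  rewrite -(subrK (u N x) (fl x)) (le_trans (rnorm_add _ _))// mulrDl lerD//.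
    exact: fN.
  exact: rnorm_bound.
exists (BoundedOp f_bounded); apply/cvg_rnormP => e e0.
have [N fN] := close (e / 2) (divr_gt0 e0 (ltr0Sn _ _)).
exists N => // n /= Nn; apply: (@le_lt_trans _ _ (e / 2)).
  by apply: rnorm_op_le => [|x]; [rewrite ltW ?divr_gt0|exact: fN].
by rewrite ltr_pdivrMr// ltr_pMr// ltr1n.
Qed.

Lemma op_cvgM u v S T : u n @[n --> \oo] --> S -> v n @[n --> \oo] --> T ->
  u n * v n @[n --> \oo] --> S * T.
Proof.
move=> /cvg_rnorm0 uS vT.
have nv : rnorm (v n) @[n --> \oo] --> rnorm T.
  move/cvg_rnormP: vT => vT; apply/cvgrPdist_lt => e e0.
  apply: filterS (vT e e0) => n; apply: le_lt_trans.
  have := rnorm_add (T - v n) (v n); have := rnorm_add (v n - T) T.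
  by rewrite !subrK (rnorm_sub (v n)) ler_norml; lra.
move/cvg_rnorm0: vT => vT.
apply/cvg_rnorm0.
apply: (@squeeze_cvgr _ _ _ _ (fun=> 0)
  (fun n => rnorm (S - u n) * rnorm (v n) + rnorm S * rnorm (T - v n))).
- near=> n; rewrite rnorm_nneg /=.
  have -> : S * T - u n * v n = (S - u n) * v n + S * (T - v n).
    by rewrite mulrBl mulrBr [RHS]addrC addrA subrK.
  by rewrite (le_trans (rnorm_add _ _))//; apply: lerD; apply: rnormM.
- exact: cvg_cst.
- have -> : (0 : R) = 0 * rnorm T + rnorm S * 0 by rewrite mul0r mulr0 addr0.
  by apply: cvgD; [exact: cvgM|apply: cvgM => //; exact: cvg_cst].
Unshelve. all: by end_near. Qed.

Lemma op_inverse_uniq T S S' : op_inverse T S -> op_inverse T S' -> S = S'.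
Proof. by move=> [ST _] [_ TS']; rewrite -[S]mulr1 -TS' mulrA ST mul1r. Qed.

Lemma op_invP T : op_invertible T -> op_inv T * T = 1 /\ T * op_inv T = 1.
Proof. by move=> [S ST]; rewrite /op_inv; case: xgetP => [S' _|/(_ S)]. Qed.

Lemma op_invE T S : S * T = 1 -> T * S = 1 -> op_inv T = S.
Proof.
by move=> ST TS; apply: op_inverse_uniq (conj ST TS); apply: op_invP; exists S.
Qed.

Lemma op_invertibleM S T : op_invertible S -> op_invertible T -> op_invertible (S * T).
Proof.
move=> [S' [SS' S'S]] [T' [TT' T'T]]; exists (T' * S'); split.
  by rewrite mulrA -(mulrA T') SS' mulr1.
by rewrite mulrA -(mulrA S) T'T mulr1.
Qed.

(** The ring of operators is trivial when [H] is zero, so it is not an algebra in the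
    sense that requires [1 != 0]; this rule and the next take the place of that
    structure. *)
Lemma op_scalerAl (a : R[i]) S T : a *: (S * T) = (a *: S) * T.
Proof. exact: bounded_opP. Qed.

Lemma op_scalerAr (a : R[i]) S T : a *: (S * T) = S * (a *: T).
Proof. by apply: bounded_opP => x /=; rewrite linearZ. Qed.

Lemma op_invertibleZ (a : R[i]) T : a != 0 -> op_invertible T -> op_invertible (a *: T).
Proof.
move=> a0 [T' [TT' T'T]]; exists (a^-1 *: T'); split;
  by rewrite -op_scalerAl -op_scalerAr ?TT' ?T'T scalerA ?mulVf ?mulfV ?scale1r.
Qed.

(** Neumann series, as the limit of the iteration [X |-> 1 + S X] from [0]. *)
Lemma Neumann_invertible S (q : R) : rnorm S <= q -> q < 1 -> op_invertible (1 - S).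
Proof.
move=> Sq q1; have q0 : 0 <= q by exact: le_trans (rnorm_nneg _) Sq.
pose u n : bounded_op H := iter n (fun X => 1 + S * X) 0.
(* the iterates commute with [S], so that the limit is a two-sided inverse *)
have uS n : u n * S = S * u n.
  elim: n => [|n IH]; first by rewrite mul0r mulr0.
  by rewrite /u /= -/(u n) mulrDl mulrDr -mulrA IH mul1r mulr1.
have du n k : rnorm (u (n + k)%N - u n) <= q ^+ n / (1 - q).
  elim: n => [|n IH].
    rewrite add0n subr0 expr0 mul1r; elim: k => [|k IH].
      by rewrite rnorm_zero invr_ge0 subr_ge0 ltW.
    rewrite /= (le_trans (rnorm_add _ _))//.
    have -> : (1 - q)^-1 = 1 + q * (1 - q)^-1 by field; rewrite subr_eq0 gt_eqF.
    rewrite lerD ?rnorm1// (le_trans (rnormM _ _))//.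
    by rewrite ler_pM ?rnorm_nneg.
  rewrite addSn /= opprD addrACA subrr add0r -mulrBr.
  by rewrite (le_trans (rnormM _ _))// exprS -mulrA ler_pM ?rnorm_nneg.
have [e e0|X uX] := op_cauchy_cvg (u := u).
  have : q ^+ n @[n --> \oo] --> (0 : R) by apply: cvg_expr; rewrite ger0_norm.
  have e'0 : 0 < e / 2 * (1 - q) by rewrite mulr_gt0 ?divr_gt0 ?subr_gt0.
  move=> /cvgrPdist_lt/(_ _ e'0)[N _ qN]; exists N.
  have uN m : (N <= m)%N -> rnorm (u m - u N) < e / 2.
    move=> Nm; rewrite -(subnKC Nm); apply: le_lt_trans (du _ _) _.
    rewrite ltr_pdivrMr ?subr_gt0//.
    by have := qN N (leqnn N); rewrite /= sub0r normrN ger0_norm ?exprn_ge0.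
  move=> m n Nm Nn; have -> : u m - u n = (u m - u N) + (u N - u n) by rewrite addrA subrK.
  rewrite (le_lt_trans (rnorm_add _ _))// [ltRHS](splitr e) ltrD ?uN//.
  by rewrite rnorm_sub uN.
have uX1 : u n.+1 @[n --> \oo] --> X by rewrite cvg_shiftS.
have Sc : (fun _ : nat => S) n @[n --> \oo] --> S by exact: cvg_cst.
have oc : (fun _ : nat => 1 : bounded_op H) n @[n --> \oo] --> (1 : bounded_op H).
  exact: cvg_cst.
exists X; split.
  rewrite mulrBr mulr1; apply/eqP; rewrite subr_eq; apply/eqP.
  apply: (seq_cvg_unique uX1).
  have -> : (fun n => u n.+1) = (fun n => 1 + u n * S).
    by apply/funext => n; rewrite uS.
  exact: cvgD oc (op_cvgM uX Sc).
rewrite mulrBl mul1r; apply/eqP; rewrite subr_eq; apply/eqP.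
exact: seq_cvg_unique uX1 (cvgD oc (op_cvgM Sc uX)).
Qed.

(** [m <= T] in the order of symmetric operators, with a scalar lower bound. *)
Definition op_ge (m : R) T := forall x, m * rnorm x ^+ 2 <= rip (T x) x.

Lemma rip_op_ub T (x : H) : rip (T x) x <= rnorm T * rnorm x ^+ 2.
Proof. exact: le_trans (ler_norm _) (rip_op_le T x x). Qed.

(** Cauchy-Schwarz for the form of [T] at [x] and [T x]. *)
Lemma nneg_rnorm_sqr T x : op_sym T -> op_ge 0 T ->
  rnorm (T x) ^+ 2 <= rnorm T * rip (T x) x.
Proof.
move=> sT T0; have T0' y : 0 <= rip (T y) y by have := T0 y; rewrite mul0r.
have [->|Tx0] := eqVneq (rnorm (T x)) 0.
  by rewrite expr0n mulr_ge0 ?rnorm_nneg.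
have {}Tx0 : 0 < rnorm (T x) ^+ 2 by rewrite exprn_gt0// lt_def Tx0 rnorm_nneg.
rewrite -(ler_pM2r Tx0) -expr2 -[in leLHS]ripxx.
apply: le_trans (form_Cauchy_Schwarz x (T x) sT T0') _.
by rewrite mulrAC mulrC ler_wpM2r// rip_op_ub.
Qed.

(** Cauchy-Schwarz for the form of [T] bounds its off-diagonal values by the diagonal
    ones. *)
Lemma nneg_rnorm_le T (q : R) : 0 <= q -> op_sym T -> op_ge 0 T ->
  (forall x, rip (T x) x <= q * rnorm x ^+ 2) -> rnorm T <= q.
Proof.
move=> q0 sT T0 Tq; apply: rnorm_op_rip => // x y.
have T0' z : 0 <= rip (T z) z by have := T0 z; rewrite mul0r.
rewrite -ler_sqr ?nnegrE ?mulr_ge0 ?rnorm_nneg// real_normK ?num_real//.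
apply: le_trans (form_Cauchy_Schwarz x y sT T0') _.
have -> : (q * (rnorm x * rnorm y)) ^+ 2 = (q * rnorm x ^+ 2) * (q * rnorm y ^+ 2).
  by ring.
by rewrite ler_pM.
Qed.

Lemma op_symD S T : op_sym S -> op_sym T -> op_sym (S + T).
Proof. by move=> sS sT x y; rewrite /= ripDl ripDr sS sT. Qed.

Lemma op_symZ (a : R) T : op_sym T -> op_sym (a%:C *: T).
Proof. by move=> sT x y; rewrite /= ripZl ripZr sT. Qed.

Lemma op_symN T : op_sym T -> op_sym (- T).
Proof. by move=> sT x y; rewrite /= ripNl ripNr sT. Qed.

Lemma op_symB S T : op_sym S -> op_sym T -> op_sym (S - T).
Proof. by move=> sS sT; apply: op_symD => //; exact: op_symN. Qed.

Lemma op_sym1 : op_sym (1 : bounded_op H).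
Proof. by []. Qed.

Lemma op_sym_sandwich S T : op_sym S -> op_sym T -> op_sym (S * T * S).
Proof. by move=> sS sT x y; rewrite /= sS sT sS. Qed.

(** A symmetric [T] with [0 < m <= T <= M] is [M (1 - S)] for a contraction [S]
    of norm at most [1 - m / M]. *)
Lemma op_ge_invertible T (m : R) : 0 < m -> op_sym T -> op_ge m T -> op_invertible T.
Proof.
move=> m0 sT Tm; pose M := rnorm T + m.
(* the term [m] keeps the upper bound [M] positive when [H] is zero *)
have M0 : 0 < M by rewrite ltr_wpDl ?rnorm_nneg.
have MT x : rip (T x) x <= M * rnorm x ^+ 2.
  by rewrite (le_trans (rip_op_ub _ _))// ler_wpM2r ?sqr_ge0// lerDl ltW.
pose S : bounded_op H := 1 - (M^-1)%:C *: T.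
have -> : T = M%:C *: (1 - S).
  by rewrite /S subKr scalerA -rmorphM /= divff ?gt_eqF// scale1r.
have SE x : rip (S x) x = rnorm x ^+ 2 - M^-1 * rip (T x) x.
  by rewrite /S /= ripBl ripZl ripxx.
apply: op_invertibleZ; first by rewrite (inj_eq (@complexI _)) gt_eqF.
apply: (@Neumann_invertible _ (1 - m / M)); last by rewrite gtrBl divr_gt0.
apply: nneg_rnorm_le => [||x|x].
- by rewrite subr_ge0 ler_pdivrMr// mul1r /M lerDr rnorm_nneg.
- by apply: op_symB; [exact: op_sym1|exact: op_symZ].
- by rewrite mul0r SE subr_ge0 mulrC ler_pdivrMr// mulrC.
- by rewrite SE mulrBl mul1r lerD2l lerN2 -mulrA mulrCA ler_wpM2l// invr_ge0 ltW.
Qed.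

Lemma op_pos_sym T : op_pos T -> op_sym T.
Proof. by move=> [/op_nneg_sym]. Qed.

(** Cauchy-Schwarz gives [T^2 <= |T| T], while invertibility bounds [T^2] from
    below. *)
Lemma sym_invertible_ge T : op_sym T -> op_ge 0 T -> op_invertible T ->
  exists2 m : R, 0 < m & op_ge m T.
Proof.
move=> sT T0 [S [ST TS]].
have T0' y : 0 <= rip (T y) y by have := T0 y; rewrite mul0r.
pose K := (rnorm S ^+ 2 + 1) * (rnorm T + 1).
have S0 : 0 < rnorm S ^+ 2 + 1 by rewrite ltr_wpDl ?sqr_ge0.
have T1 : 0 < rnorm T + 1 by rewrite ltr_wpDl ?rnorm_nneg.
have K0 : 0 < K by exact: mulr_gt0.
exists K^-1; first by rewrite invr_gt0.
move=> x; rewrite mulrC ler_pdivrMr//.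
have xS : rnorm x ^+ 2 <= (rnorm S ^+ 2 + 1) * rnorm (T x) ^+ 2.
  have {1}-> : x = S (T x) by rewrite -[RHS]/((S * T) x) ST.
  rewrite (@le_trans _ _ (rnorm S ^+ 2 * rnorm (T x) ^+ 2))//.
    by rewrite -exprMn lerXn2r ?nnegrE ?mulr_ge0 ?rnorm_nneg ?rnorm_bound.
  by rewrite ler_wpM2r ?sqr_ge0// lerDl.
apply: (le_trans xS).
rewrite [leRHS](_ : _ = (rnorm S ^+ 2 + 1) * ((rnorm T + 1) * rip (T x) x)).
  2: by rewrite /K; ring.
rewrite ler_pM2l//.
apply: le_trans (nneg_rnorm_sqr x sT T0) _.
by rewrite ler_wpM2r// lerDl.
Qed.

Lemma op_pos_ge T : op_pos T -> exists2 m : R, 0 < m & op_ge m T.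
Proof.
move=> posT; apply: sym_invertible_ge; first exact: op_pos_sym.
  by move=> x; rewrite mul0r; apply: op_nneg_rip; case: posT.
by case: posT.
Qed.

End Completeness.

(** * Spectral bound for polynomials of a symmetric operator *)

Section Spectral.
Context {R : realType} {H : hilbertType R}.
Implicit Types (S T : bounded_op H).

(** Polynomials of an operator, with complex coefficients: the spectral bound factors
    real polynomials over [R[i]]. *)
Definition op_chorner (p : {poly R[i]}) T : bounded_op H :=
  \sum_(i < size p) p`_i *: T ^+ i.

Lemma op_chorner_widen (n : nat) (p : {poly R[i]}) T : (size p <= n)%N ->
  op_chorner p T = \sum_(i < n) p`_i *: T ^+ i.
Proof.
move=> pn; rewrite /op_chorner (big_ord_widen n (fun i => p`_i *: T ^+ i) pn) big_mkcond /=.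
apply: eq_bigr => i _; case: ltnP => // ip.
by rewrite nth_default// scale0r.
Qed.

Lemma op_chornerD (p q : {poly R[i]}) T : op_chorner (p + q) T = op_chorner p T + op_chorner q T.
Proof.
have pn := leq_maxl (size p) (size q); have qn := leq_maxr (size p) (size q).
rewrite (op_chorner_widen T (leq_trans (size_polyD p q) (leqnn _))).
rewrite (op_chorner_widen T pn) (op_chorner_widen T qn) -big_split /=.
by apply: eq_bigr => i _; rewrite coefD scalerDl.
Qed.

Lemma op_chornerZ a (p : {poly R[i]}) T : op_chorner (a *: p) T = a *: op_chorner p T.
Proof.
rewrite (op_chorner_widen T (size_scale_leq a p)) /op_chorner scaler_sumr.
by apply: eq_bigr => i _; rewrite coefZ scalerA.
Qed.

Lemma op_chornerC a T : op_chorner a%:P T = a *: (1 : bounded_op H).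
Proof.
by rewrite (op_chorner_widen T (size_polyC_leq1 a)) big_ord1 coefC eqxx expr0.
Qed.

Lemma op_chornerMX (p : {poly R[i]}) T : op_chorner (p * 'X) T = op_chorner p T * T.
Proof.
have pn : (size (p * 'X)%R <= (size p).+1)%N.
  by rewrite (leq_trans (size_polyMleq _ _))// size_polyX addn2.
rewrite (op_chorner_widen T pn) big_ord_recl coefMX eqxx scale0r add0r.
rewrite /op_chorner mulr_suml; apply: eq_bigr => i _.
by rewrite coefMX /= /bump /= add1n exprSr op_scalerAl.
Qed.

Lemma op_chornerM (p q : {poly R[i]}) T : op_chorner (p * q) T = op_chorner p T * op_chorner q T.
Proof.
elim/poly_ind: q p => [|q c IH] p.
  by rewrite mulr0 -[0]/(0%:P : {poly R[i]}) !op_chornerC !scale0r mulr0.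
rewrite mulrDr op_chornerD mulrA op_chornerMX IH op_chornerD op_chornerMX op_chornerC.
rewrite [p * _]mulrC mul_polyC op_chornerZ mulrDr mulrA; congr (_ + _).
by rewrite -op_scalerAr mulr1.
Qed.

Lemma op_chornerX T : op_chorner 'X T = T.
Proof. by rewrite -['X]mul1r op_chornerMX op_chornerC scale1r mul1r. Qed.

Lemma op_hornerE p T : op_horner p T = op_chorner (map_poly (real_complex R) p) T.
Proof.
rewrite /op_horner /op_chorner size_map_poly; apply: eq_bigr => i _.
by rewrite coef_map.
Qed.

Lemma op_hornerD p q T : op_horner (p + q) T = op_horner p T + op_horner q T.
Proof. by rewrite !op_hornerE rmorphD op_chornerD. Qed.

Lemma op_hornerM p q T : op_horner (p * q) T = op_horner p T * op_horner q T.
Proof. by rewrite !op_hornerE rmorphM op_chornerM. Qed.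

Lemma op_hornerC a T : op_horner a%:P T = a%:C *: (1 : bounded_op H).
Proof. by rewrite !op_hornerE map_polyC op_chornerC. Qed.

Lemma op_hornerX T : op_horner 'X T = T.
Proof. by rewrite !op_hornerE map_polyX op_chornerX. Qed.

Lemma op_hornerZ a p T : op_horner (a *: p) T = a%:C *: op_horner p T.
Proof. by rewrite -mul_polyC op_hornerM op_hornerC -op_scalerAl mul1r. Qed.

Lemma op_hornerN p T : op_horner (- p) T = - op_horner p T.
Proof. by rewrite -scaleN1r op_hornerZ rmorphN1 scaleN1r. Qed.

Lemma op_hornerB p q T : op_horner (p - q) T = op_horner p T - op_horner q T.
Proof. by rewrite op_hornerD op_hornerN. Qed.

Lemma op_sym_horner p T : op_sym T -> op_sym (op_horner p T).
Proof.
move=> sT; rewrite /op_horner; elim/big_ind: _ => [x y|S1 S2|i _].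
- by rewrite /= rip0l ripC rip0l.
- exact: op_symD.
- apply: op_symZ; elim: (i : nat) => [//|n IH] x y.
  by rewrite {1}exprS [LHS]sT IH exprSr.
Qed.

(** Factor [q] into linear factors: if every [T - z] were invertible for [z] a root of
    [q], so would be their product. *)
Lemma spectrum_poly_root (q : {poly R[i]}) T : q != 0 ->
  ~ op_invertible (op_chorner q T) -> exists2 z, root q z & spectrum T z.
Proof.
move=> q0 qT; have [r qE] := closed_field_poly_normal q.
apply: contrapT => noroot; apply: qT; rewrite qE op_chornerZ.
apply: op_invertibleZ; first by rewrite lead_coef_eq0.
have : {in r, forall z, op_invertible (T - z *: (1 : bounded_op H))}.
  move=> z zr; apply: contrapT => Tz; apply: noroot; exists z => //.
  by rewrite qE rootZ ?lead_coef_eq0// root_prod_XsubC.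
elim: r {qE} => [|z r IH] rT.
  by rewrite big_nil op_chornerC scale1r; exists 1; rewrite /op_inverse /= mulr1.
rewrite big_cons op_chornerM; apply: op_invertibleM.
  rewrite op_chornerD -polyCN op_chornerX op_chornerC scaleNr.
  by apply: rT; rewrite mem_head.
by apply: IH => y yr; apply: rT; rewrite inE yr orbT.
Qed.

(** A left and a right inverse of [S] are read off from an inverse of [S T]. *)
Lemma op_invertible_commM S T : S * T = T * S ->
  op_invertible (S * T) -> op_invertible S.
Proof.
move=> ST [U [UST STU]].
have US : (U * T) * S = 1 by rewrite -mulrA -ST.
have SU : S * (T * U) = 1 by rewrite mulrA.
exists (U * T); split => //.
suff -> : U * T = T * U by [].
by rewrite -[LHS]mulr1 -SU mulrA US mul1r.
Qed.

Lemma op_mul_sub_scalar S (a b : R[i]) :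
  (S - a *: (1 : bounded_op H)) * (S - b *: (1 : bounded_op H)) =
  S * S - (a + b) *: S + (a * b) *: (1 : bounded_op H).
Proof.
rewrite mulrBl !mulrBr -!op_scalerAl -!op_scalerAr !mulr1 !mul1r scalerA.
rewrite opprB scalerDl opprD -!addrA; congr (_ + _).
by rewrite [RHS]addrCA [_ - a *: S]addrC.
Qed.

(** For [z = x + i y], the product [(T - z) (T - conj z) = (T - x)^2 + y^2] is
    bounded below by [y^2]. *)
Lemma sym_spectrum_real T z : op_sym T -> spectrum T z -> z = (complex.Re z)%:C.
Proof.
case: z => x y sT /= Tz; suff -> : y = 0 by [].
apply: contrapT => /eqP y0; apply: Tz.
pose S : bounded_op H := T - x%:C *: (1 : bounded_op H).
have E (u : R) : T - (x +i* u) *: (1 : bounded_op H) = S - ('i * u%:C) *: (1 : bounded_op H).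
  rewrite /S -addrA -opprD -scalerDl; congr (_ - _ *: _).
  by apply/eqP; rewrite eq_complex /=; apply/andP; split; apply/eqP; ring.
have sS : op_sym S by apply: op_symB => //; apply: op_symZ; exact: op_sym1.
have prodE := op_mul_sub_scalar S.
rewrite E; apply: (@op_invertible_commM _ (S - ('i * (- y)%:C) *: (1 : bounded_op H))).
  by rewrite !prodE [b in _ - b *: S]addrC [_ * (_ * (- y)%:C)]mulrC.
rewrite prodE.
have -> : 'i * y%:C + 'i * (- y)%:C = 0 :> R[i].
  by apply/eqP; rewrite eq_complex /=; apply/andP; split; apply/eqP; ring.
have -> : 'i * y%:C * ('i * (- y)%:C) = (y ^+ 2)%:C :> R[i].
  by apply/eqP; rewrite eq_complex /=; apply/andP; split; apply/eqP; ring.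
rewrite scale0r subr0; apply: (@op_ge_invertible _ _ _ (y ^+ 2)).
- by rewrite lt_def sqrf_eq0 y0 sqr_ge0.
- apply: op_symD; last by apply: op_symZ; exact: op_sym1.
  by move=> u v; rewrite /= !sS.
- by move=> u; rewrite /= ripDl ripZl ripxx sS ripxx lerDr sqr_ge0.
Qed.

(** The norm of a symmetric [S] is attained up to sign in its spectrum: if
    [|S|^2 - S^2] were invertible it would be bounded below, and [|S|] could be
    decreased. The conclusion [1 = 0] means that [H] is the zero space. *)
Lemma sym_norm_noninvertible S : op_sym S ->
  op_invertible ((rnorm S ^+ 2)%:C *: (1 : bounded_op H) - S * S) -> 1 = 0 :> bounded_op H.
Proof.
move=> sS; set Q := _ - _ => Qinv.
have QE x : rip (Q x) x = rnorm S ^+ 2 * rnorm x ^+ 2 - rnorm (S x) ^+ 2.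
  by rewrite /Q /= ripBl ripZl sS !ripxx.
have [|||m m0 Qm] := @sym_invertible_ge _ _ Q.
- apply: op_symB; first by apply: op_symZ; exact: op_sym1.
  by move=> u v; rewrite /= !sS.
- move=> x; rewrite mul0r QE subr_ge0 -exprMn lerXn2r ?nnegrE ?mulr_ge0 ?rnorm_nneg//.
  exact: rnorm_bound.
- by [].
have Sx x : rnorm (S x) ^+ 2 <= (rnorm S ^+ 2 - m) * rnorm x ^+ 2.
  by have := Qm x; rewrite QE; lra.
pose c := Num.max (rnorm S ^+ 2 - m) 0.
have c0 : 0 <= c by rewrite le_max lexx orbT.
have : rnorm S <= Num.sqrt c.
  apply: rnorm_op_le => [|x]; first exact: sqrtr_ge0.
  rewrite -ler_sqr ?nnegrE ?mulr_ge0 ?sqrtr_ge0 ?rnorm_nneg// exprMn sqr_sqrtr//.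
  by rewrite (le_trans (Sx x))// ler_wpM2r ?sqr_ge0// le_max lexx.
rewrite -ler_sqr ?nnegrE ?sqrtr_ge0 ?rnorm_nneg// sqr_sqrtr// /c le_max => /orP[|N0].
  by rewrite lerBrDr gerDl leNgt m0.
have {}N0 : rnorm S = 0.
  by apply/eqP; rewrite -sqrf_eq0; apply/eqP/le_anti; rewrite N0 sqr_ge0.
have [U [UQ _]] := Qinv.
move: UQ; rewrite /Q N0 (rnorm_eq0P N0) expr0n scale0r mulr0 subr0 mulr0.
by move=> ->.
Qed.

(** With [N = |p(T)|], the operator [N^2 - p(T)^2] is not invertible, so some root
    of [N^2 - p^2] lies in the spectrum of [T]. *)
Lemma spectral_bound (p : {poly R}) T (K : R) : op_sym T -> 0 <= K ->
  (forall t : R, spectrum T t%:C -> `|p.[t]| <= K) -> rnorm (op_horner p T) <= K.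
Proof.
move=> sT K0 pK; rewrite leNgt; apply/negP => KN.
have nz : (1 : bounded_op H) <> 0.
  move=> one0; move: KN; rewrite -[op_horner p T]mul1r one0 mul0r rnorm_zero.
  by rewrite ltNge K0.
have key (q : {poly R}) :
    let Q : {poly R} := (rnorm (op_horner q T) ^+ 2)%:P - q * q in
    Q != 0 -> exists2 t : R, root Q t & spectrum T t%:C.
  move=> Q Q0; have [||z Qz Tz] := @spectrum_poly_root (map_poly (real_complex R) Q) T.
  - by rewrite map_poly_eq0.
  - rewrite -op_hornerE op_hornerB op_hornerC op_hornerM => Qinv; apply: nz.
    by apply: sym_norm_noninvertible Qinv; exact: op_sym_horner.
  - have zE := sym_spectrum_real sT Tz; move: Qz; rewrite zE fmorph_root => Qz.
    by exists (complex.Re z); rewrite -?zE.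
have val (t : R) : root ((rnorm (op_horner p T) ^+ 2)%:P - p * p) t ->
    `|p.[t]| = rnorm (op_horner p T).
  rewrite rootE !hornerE subr_eq0 -expr2 eqf_sqr.
  by move=> /orP[]/eqP E; [rewrite -E|rewrite -normrN -E]; rewrite ger0_norm ?rnorm_nneg.
(* if [N^2 - p^2] vanishes identically any point of the spectrum will do, and the
   same argument for the polynomial ['X] provides one *)
have [q0|/key[t pt Tt]] := eqVneq ((rnorm (op_horner p T) ^+ 2)%:P - p * p) 0; last first.
  by have := pK t Tt; rewrite val// leNgt KN.
have [|t _ Tt] := key 'X.
  apply/eqP => /(congr1 (fun q : {poly R} => q`_2)) /eqP.
  by rewrite -expr2 coefB coefC coefXn coef0 sub0r oppr_eq0 oner_eq0.
by have := pK t Tt; rewrite val ?q0 ?root0// leNgt KN.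
Qed.

Lemma sym_spectrum_ge T (m t : R) : op_sym T -> op_ge m T -> spectrum T t%:C -> m <= t.
Proof.
move=> sT Tm Tt; rewrite leNgt; apply/negP => tm; apply: Tt.
apply: (@op_ge_invertible _ _ _ (m - t)); first by rewrite subr_gt0.
  by apply: op_symB => //; apply: op_symZ; exact: op_sym1.
by move=> x; rewrite /= ripBl ripZl ripxx mulrBl lerD2r.
Qed.

Lemma sym_spectrum_le T (t : R) : op_sym T -> spectrum T t%:C -> t <= rnorm T.
Proof.
move=> sT Tt; rewrite leNgt; apply/negP => tm; apply: Tt.
have -> : T - t%:C *: (1 : bounded_op H) = (-1) *: (t%:C *: (1 : bounded_op H) - T).
  by rewrite scaleN1r opprB.
apply: op_invertibleZ; first by rewrite oppr_eq0 oner_eq0.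
apply: (@op_ge_invertible _ _ _ (t - rnorm T)); first by rewrite subr_gt0.
  by apply: op_symB => //; apply: op_symZ; exact: op_sym1.
by move=> x; rewrite /= ripBl ripZl ripxx mulrBl lerB// rip_op_ub.
Qed.

End Spectral.

(** * Continuous functional calculus *)

Section PolynomialApproximation.
Context {R : realType}.
Implicit Types (K : set R) (f g : R -> R).

(** Uniform approximability on [K] by real polynomials; on the spectrum of a symmetric
    operator this is exactly what makes [f(T)] exist. *)
Definition poly_approx K f := forall e : R, 0 < e ->
  exists p : {poly R}, forall t, K t -> `|p.[t] - f t| <= e.

Lemma poly_approx_lim K f :
  (forall e : R, 0 < e -> exists2 g, poly_approx K g &
     forall t, K t -> `|g t - f t| <= e) -> poly_approx K f.
Proof.
move=> fK e e0; have e20 : 0 < e / 2 by exact: divr_gt0.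
have [g gK gf] := fK _ e20; have [p pg] := gK _ e20.
exists p => t Kt; rewrite -[p.[t]](subrK (g t)) -addrA [leRHS]splitr.
by rewrite (le_trans (ler_normD _ _))// lerD ?pg ?gf.
Qed.

Lemma eq_poly_approx K f g : (forall t, K t -> f t = g t) ->
  poly_approx K f -> poly_approx K g.
Proof. by move=> fg fK e /fK[p pf]; exists p => t Kt; rewrite -fg ?pf. Qed.

(** The iteration [y |-> y (3 - t y^2) / 2] for [t^(-1/2)]: it squares the defect
    [1 - t y^2], up to a factor in [[3/4, 1]], and the starting value [M^(-1/2)]
    makes that defect at most [1 - m / M] on [[m, M]]. *)
Lemma poly_approx_inv_sqrt (m M : R) : 0 < m -> m <= M ->
  poly_approx `[m, M] (fun t => t `^ (- 2^-1)).
Proof.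
move=> m0 mM e e0; have M0 : 0 < M by exact: lt_le_trans mM.
have sqr_invsqrt (t : R) : 0 < t -> t * (t `^ (- 2^-1)) ^+ 2 = 1.
  move=> t0; rewrite -powR_mulrn ?powR_ge0// -powRrM mulNr mulVf// -{1}(powRr1 (ltW t0)).
  by rewrite -powRD ?subrr ?powRr0// (gt_eqF t0) implybT.
pose s t : R := t `^ (- 2^-1).
pose y n := iter n (fun p : {poly R} => 2^-1%:P * p * (3%:P - 'X * p ^+ 2)) (s M)%:P.
(* the bound on the initial defect [1 - t / M] *)
pose q := 1 - m / M.
have q0 : 0 <= q by rewrite subr_ge0 ler_pdivrMr// mul1r.
have q1 : q < 1 by rewrite gtrBl divr_gt0.
have yP n t : m <= t <= M ->
    0 <= (y n).[t] /\ 0 <= 1 - t * (y n).[t] ^+ 2 <= q ^+ n.+1.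
  move=> /andP[mt tM]; have t0 : 0 < t by exact: lt_le_trans mt.
  elim: n => [|n [yn0 /andP[d0 dq]]].
    rewrite /y /= hornerC; split; first exact: powR_ge0.
    have -> : s M ^+ 2 = M^-1.
      by apply: (mulfI (x := M)); rewrite ?gt_eqF// sqr_invsqrt// mulfV ?gt_eqF.
    by rewrite subr_ge0 ler_pdivrMr// mul1r tM expr1 lerD2l lerN2 ler_pM2r ?invr_gt0.
  have -> : (y n.+1).[t] = 2^-1 * (y n).[t] * (3 - t * (y n).[t] ^+ 2).
    by rewrite /y iterS -/(y n) !hornerE.
  set z := (y n).[t] in yn0 d0 dq *; set d := 1 - t * z ^+ 2 in d0 dq.
  have d1 : d <= 1 by rewrite /d gerBl mulr_ge0 ?sqr_ge0// ltW.
  have tz : t * z ^+ 2 = 1 - d by rewrite /d; ring.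
  (* in terms of the defect, the step is [y |-> y (2 + d) / 2] and
     [d |-> d^2 (3 + d) / 4] *)
  clearbody d; have -> : 3 - t * z ^+ 2 = 2 + d by rewrite tz; ring.
  split; first by apply: mulr_ge0; [apply: mulr_ge0; rewrite ?invr_ge0|apply: addr_ge0].
  have -> : 1 - t * (2^-1 * z * (2 + d)) ^+ 2 = d ^+ 2 * ((3 + d) / 4).
    have -> : t * (2^-1 * z * (2 + d)) ^+ 2 = (t * z ^+ 2) * (2 + d) ^+ 2 / 4 by field.
    by rewrite tz; field.
  apply/andP; split; first by rewrite mulr_ge0 ?sqr_ge0 ?divr_ge0 ?addr_ge0.
  have dq1 : d <= q.
    by rewrite (le_trans dq)// exprS ler_piMr// exprn_ile1// ltW.
  rewrite (@le_trans _ _ (d ^+ 2))//.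
    by rewrite ler_piMr ?sqr_ge0// ler_pdivrMr// mul1r; lra.
  by rewrite expr2 exprS ler_pM.
have m10 : 0 < 1 + m^-1 by rewrite addr_gt0 ?invr_gt0.
have : q ^+ n @[n --> \oo] --> (0 : R) by apply: cvg_expr; rewrite ger0_norm.
move=> /cvgrPdist_lt/(_ _ (divr_gt0 e0 m10))[N _ qN].
exists (y N) => t /=; rewrite in_itv /= => mtM.
have [yN0 /andP[d0 dq]] := yP N t mtM; move/andP: mtM => [mt tM].
have t0 : 0 < t by exact: lt_le_trans mt.
have s0 : 0 < s t by rewrite powR_gt0.
have st := sqr_invsqrt t t0; rewrite -/(s t) in st *.
have ys : (y N).[t] <= s t.
  by rewrite -ler_sqr ?nnegrE ?(ltW s0)// -(ler_pM2l t0) st -subr_ge0.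
rewrite distrC ger0_norm ?subr_ge0//.
have sm : s t <= 1 + m^-1.
  have s2 : s t ^+ 2 <= m^-1.
    by rewrite -(ler_pM2l t0) st ler_pdivlMr// mul1r.
  have := sqr_ge0 (s t - 1); rewrite sqrrB; lra.
have d2 : s t - (y N).[t] <= (1 - t * (y N).[t] ^+ 2) * s t.
  have -> : (1 - t * (y N).[t] ^+ 2) * s t =
      (s t - (y N).[t]) * (t * s t ^+ 2 + t * s t * (y N).[t]).
    by rewrite -{1}st; ring.
  rewrite ler_peMr ?subr_ge0// st lerDl.
  by rewrite !mulr_ge0// ltW.
apply: (le_trans d2); apply: (@le_trans _ _ (q ^+ N.+1 * (1 + m^-1))).
  by rewrite ler_pM// ltW.
rewrite -ler_pdivlMr//; apply: le_trans (_ : q ^+ N <= _).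
  by rewrite exprS ler_piMl ?exprn_ge0// ltW.
by have := qN N (leqnn N); rewrite /= sub0r normrN ger0_norm ?exprn_ge0// => /ltW.
Qed.

Lemma horner_bounded (N : R) (p : {poly R}) :
  exists c : R, forall t, `|t| <= N -> `|p.[t]| <= c.
Proof.
elim/poly_ind: p => [|p a [c pc]]; first by exists 0 => t _; rewrite horner0 normr0.
exists (`|c| * N + `|a|) => t tN; rewrite hornerMXaddC (le_trans (ler_normD _ _))//.
by rewrite lerD2r normrM ler_pM// (le_trans (pc t tN)) ?ler_norm.
Qed.

Lemma poly_approx_bounded K (N : R) f : (forall t, K t -> `|t| <= N) ->
  poly_approx K f -> exists2 c : R, 0 <= c & forall t, K t -> `|f t| <= c.
Proof.
move=> KN fK; have [p pf] := fK 1 ltr01; have [c pc] := horner_bounded N p.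
exists (`|c| + 1); first by rewrite addr_ge0.
move=> t Kt; rewrite -[f t](subKr p.[t]) (le_trans (ler_normB _ _))//.
by rewrite lerD ?pf// (le_trans (pc t (KN t Kt))) ?ler_norm.
Qed.

(** On a bounded set polynomials are bounded, so that uniform limits of polynomials are
    closed under products. *)
Lemma poly_approxM K (N : R) f g : (forall t, K t -> `|t| <= N) ->
  poly_approx K f -> poly_approx K g -> poly_approx K (fun t => f t * g t).
Proof.
move=> KN fK gK e e0.
have [c c0 fc] := poly_approx_bounded KN fK.
have [d d0 gd] := poly_approx_bounded KN gK.
have cd0 : 0 < c + d + 1 by rewrite ltr_wpDl ?addr_ge0.
pose e' := Num.min 1 (e / (c + d + 1)).
have e'0 : 0 < e' by rewrite lt_min ltr01 divr_gt0.
have [p pf] := fK _ e'0; have [q qg] := gK _ e'0; exists (p * q) => t Kt.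
have p1 : `|p.[t]| <= c + 1.
  rewrite -[p.[t]](subrK (f t)) addrC (le_trans (ler_normD _ _))// lerD ?fc//.
  by rewrite (le_trans (pf t Kt))// ge_min lexx.
have -> : (p * q).[t] - f t * g t = p.[t] * (q.[t] - g t) + (p.[t] - f t) * g t.
  by rewrite hornerM; ring.
rewrite (le_trans (ler_normD _ _))// !normrM.
apply: (@le_trans _ _ ((c + 1) * e' + e' * d)).
  by apply: lerD; apply: ler_pM => //; [exact: qg|exact: pf|exact: gd].
have : e' <= e / (c + d + 1) by rewrite ge_min lexx orbT.
rewrite ler_pdivlMr//; lra.
Qed.

(** [1 / (t + l)] is the square of the inverse square root, shifted by [l]. *)
Lemma poly_approx_resolvent K (l M : R) : 0 < l -> (forall t, K t -> 0 <= t <= M) ->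
  poly_approx K (fun t => (t + l)^-1).
Proof.
move=> l0 KM; have [[t0 Kt0]|K0] := pselect (exists t, K t); last first.
  by move=> e e0; exists 0 => t Kt; case: K0; exists t.
have M0 : 0 <= M by have /andP[] := KM _ Kt0; exact: le_trans.
have KN t : K t -> `|t| <= M by move=> /KM /andP[t00 tM]; rewrite ger0_norm.
have sK : poly_approx K (fun t => (t + l) `^ (- 2^-1)).
  move=> e e0; have lMl : l <= M + l by rewrite lerDr.
  have [p pP] := poly_approx_inv_sqrt l0 lMl e0; exists (p \Po ('X + l%:P)) => t Kt.
  rewrite horner_comp !hornerE; apply: pP; rewrite /= in_itv /= lerD2r lerDr.
  exact: KM.
apply: eq_poly_approx (poly_approxM KN sK sK) => t /KM /andP[t00 _].
have tl0 : 0 < t + l by rewrite ltr_wpDl.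
rewrite -powRD ?(gt_eqF tl0) ?implybT// -opprD -{2}[2^-1]mul1r -{1}[2^-1]mul1r -splitr.
by rewrite powR_inv1 ?ltW.
Qed.

End PolynomialApproximation.

Section ContinuousFunctionalCalculus.
Context {R : realType} {H : hilbertType R}.
Variable T : bounded_op H.
Hypothesis sT : op_sym T.
Implicit Types (S : bounded_op H) (f g : R -> R).

Definition rspectrum : set R := [set t | spectrum T t%:C].

Lemma rspectrum_bounded t : rspectrum t -> `|t| <= rnorm T.
Proof.
move=> Tt; rewrite ler_norml (sym_spectrum_le sT Tt) andbT.
apply: (sym_spectrum_ge sT _ Tt) => x.
by rewrite mulNr lerNl (le_trans _ (rip_op_le T x x))// -normrN ler_norm.
Qed.

(** The calculus does not increase norms: pass to the limit in the bound for
    polynomials. Uniqueness of [f(T)] is the case [c = 0]. *)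
Lemma is_cfc_dist f g S S' (c : R) : 0 <= c -> is_cfc f T S -> is_cfc g T S' ->
  (forall t, rspectrum t -> `|f t - g t| <= c) -> rnorm (S - S') <= c.
Proof.
move=> c0 [p [pf /cvg_rnormP pS]] [q [qg /cvg_rnormP qS']] fg.
apply/ler_addgt0Pr => e e0; have e40 : 0 < e / 4 by exact: divr_gt0.
have [n [[[H1 H2] H3] H4]] : exists n,
   ((((forall t, rspectrum t -> `|(p n).[t] - f t| <= e / 4)
     /\ (forall t, rspectrum t -> `|(q n).[t] - g t| <= e / 4))
     /\ rnorm (S - op_horner (p n) T) < e / 4)
     /\ rnorm (S' - op_horner (q n) T) < e / 4).
  near \oo => n; exists n; split; [split; [split|]|]; near: n;
    [exact: pf|exact: qg|exact: pS|exact: qS'].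
have H5 : rnorm (op_horner (p n) T - op_horner (q n) T) <= c + e / 4 + e / 4.
  rewrite -op_hornerB; apply: spectral_bound => // [|t Tt].
    by rewrite !addr_ge0// ltW.
  rewrite hornerD hornerN.
  have -> : (p n).[t] - (q n).[t]
    = (f t - g t) + ((p n).[t] - f t) - ((q n).[t] - g t) by ring.
  rewrite (le_trans (ler_normB _ _))// lerD ?H2// (le_trans (ler_normD _ _))//.
  by rewrite lerD ?H1 ?fg.
have -> : S - S' = (S - op_horner (p n) T) + (op_horner (p n) T - op_horner (q n) T)
   - (S' - op_horner (q n) T) by rewrite addrA subrK opprB addrA subrK.
have := rnorm_add (S - op_horner (p n) T + (op_horner (p n) T - op_horner (q n) T))
  (- (S' - op_horner (q n) T)).
have := rnorm_add (S - op_horner (p n) T) (op_horner (p n) T - op_horner (q n) T).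
rewrite rnorm_opp; lra.
Unshelve. all: by end_near. Qed.

Lemma is_cfc_uniq f g S S' : is_cfc f T S -> is_cfc g T S' ->
  (forall t, rspectrum t -> f t = g t) -> S = S'.
Proof.
move=> fS gS' fg; apply/eqP; rewrite -subr_eq0; apply/eqP/rnorm_eq0P/le_anti.
rewrite rnorm_nneg andbT; apply: is_cfc_dist fS gS' _ => // t Tt.
by rewrite fg ?subrr ?normr0.
Qed.

Lemma cfcE f S : is_cfc f T S -> cfc f T = S.
Proof.
move=> fS; rewrite /cfc; case: xgetP => [S' _ fS'|/(_ S)//].
exact: is_cfc_uniq fS' fS _.
Qed.

(** The norm bound turns uniformly converging polynomials into a Cauchy sequence of
    operators. *)
Lemma poly_approx_is_cfc f : poly_approx rspectrum f -> is_cfc f T (cfc f T).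
Proof.
move=> fK; suff [S fS] : exists S, is_cfc f T S by rewrite (cfcE fS).
have /choice[p pP] : forall n : nat, exists p : {poly R}, forall t, rspectrum t ->
    `|p.[t] - f t| <= n.+1%:R^-1 by move=> n; apply: fK; rewrite invr_gt0.
have small (e : R) : 0 < e -> exists N, forall n, (N <= n)%N -> n.+1%:R^-1 < e :> R.
  move=> e0; have := cvg_harmonic (R := R); move=> /cvgrPdist_lt/(_ e e0)[N _ HN].
  by exists N => n /HN; rewrite /= sub0r normrN ger0_norm.
have [e e0|S pS] := @op_cauchy_cvg _ _ (fun n => op_horner (p n) T).
  have [N HN] := small (e / 3) (divr_gt0 e0 (ltr0Sn _ _)).
  exists N => m n Nm Nn; rewrite -op_hornerB.
  apply: (@le_lt_trans _ _ (e / 3 + e / 3)); last by lra.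
  apply: spectral_bound => // [|t Tt]; first by rewrite addr_ge0 ?divr_ge0 ?ltW.
  rewrite hornerD hornerN.
  have -> : (p m).[t] - (p n).[t] = ((p m).[t] - f t) - ((p n).[t] - f t) by ring.
  rewrite (le_trans (ler_normB _ _))// lerD// (le_trans (pP _ _ Tt))// ltW// HN//.
exists S, p; split=> // e e0; have [N HN] := small e e0; exists N => // n /= Nn t Tt.
by rewrite (le_trans (pP _ _ Tt))// ltW// HN.
Qed.

Lemma is_cfc_approx f S : is_cfc f T S -> poly_approx rspectrum f.
Proof. by move=> [p [pf _]] e /pf[N _ HN]; exists (p N) => t; apply: (HN N (leqnn N)). Qed.

Lemma eq_is_cfc f g S : (forall t, rspectrum t -> f t = g t) ->
  is_cfc f T S -> is_cfc g T S.
Proof.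
move=> fg [p [pf pS]]; exists p; split=> // e e0; apply: filterS (pf e e0) => n pn t Tt.
by rewrite -fg ?pn.
Qed.

Lemma is_cfc_horner (p : {poly R}) : is_cfc (horner p) T (op_horner p T).
Proof.
exists (fun=> p); split; last exact: cvg_cst.
by move=> e e0; near=> n => t _; rewrite subrr normr0 ltW.
Unshelve. all: by end_near. Qed.

Lemma is_cfc_cst (a : R) : is_cfc (fun=> a) T (a%:C *: (1 : bounded_op H)).
Proof.
by rewrite -(op_hornerC _ T); apply: eq_is_cfc (is_cfc_horner _) => t _; rewrite hornerC.
Qed.

Lemma is_cfc_id : is_cfc id T T.
Proof.
rewrite -{2}(op_hornerX T); apply: eq_is_cfc (is_cfc_horner _) => t _.
by rewrite hornerX.
Qed.

Lemma is_cfcD f g S S' : is_cfc f T S -> is_cfc g T S' ->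
  is_cfc (fun t => f t + g t) T (S + S').
Proof.
move=> [p [pf pS]] [q [qg qS']]; exists (fun n => p n + q n); split.
  move=> e e0; have e20 : 0 < e / 2 by exact: divr_gt0.
  near=> n => t Tt; rewrite hornerD opprD addrACA [leRHS]splitr.
  rewrite (le_trans (ler_normD _ _))// lerD//; move: t Tt; near: n;
    [exact: pf|exact: qg].
rewrite (_ : (fun n => _) = (fun n => op_horner (p n) T + op_horner (q n) T)).
  exact: cvgD.
by apply/funext => n; rewrite op_hornerD.
Unshelve. all: by end_near. Qed.

(** As for uniform approximation, boundedness on the spectrum makes products converge. *)
Lemma is_cfcM f g S S' : is_cfc f T S -> is_cfc g T S' ->
  is_cfc (fun t => f t * g t) T (S * S').
Proof.
move=> fS gS'.
have [c c0 fc] := poly_approx_bounded rspectrum_bounded (is_cfc_approx fS).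
have [d d0 gd] := poly_approx_bounded rspectrum_bounded (is_cfc_approx gS').
have cd0 : 0 < c + d + 1 by rewrite ltr_wpDl ?addr_ge0.
move: fS gS' => [p [pf pS]] [q [qg qS']]; exists (fun n => p n * q n); split.
  move=> e e0; pose e' := Num.min 1 (e / (c + d + 1)).
  have e'0 : 0 < e' by rewrite lt_min ltr01 divr_gt0.
  near=> n.
  have pfn : forall t, rspectrum t -> `|(p n).[t] - f t| <= e' by near: n; exact: pf.
  have qgn : forall t, rspectrum t -> `|(q n).[t] - g t| <= e' by near: n; exact: qg.
  move=> t Tt; have pft := pfn t Tt; have qgt := qgn t Tt.
  have p1 : `|(p n).[t]| <= c + 1.
    rewrite -[(p n).[t]](subrK (f t)) addrC (le_trans (ler_normD _ _))// lerD ?fc//.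
    by rewrite (le_trans pft)// ge_min lexx.
  have -> : (p n * q n).[t] - f t * g t =
      (p n).[t] * ((q n).[t] - g t) + ((p n).[t] - f t) * g t.
    by rewrite hornerM; ring.
  rewrite (le_trans (ler_normD _ _))// !normrM.
  apply: (@le_trans _ _ ((c + 1) * e' + e' * d)).
    by apply: lerD; apply: ler_pM => //; exact: gd.
  have : e' <= e / (c + d + 1) by rewrite ge_min lexx orbT.
  rewrite ler_pdivlMr//; lra.
rewrite (_ : (fun n => _) = (fun n => op_horner (p n) T * op_horner (q n) T)).
  exact: op_cvgM.
by apply/funext => n; rewrite op_hornerM.
Unshelve. all: by end_near. Qed.

Lemma is_cfcZ (a : R) f S : is_cfc f T S -> is_cfc (fun t => a * f t) T (a%:C *: S).
Proof.
by move=> fS; have := is_cfcM (is_cfc_cst a) fS; rewrite -op_scalerAl mul1r.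
Qed.

Lemma is_cfc_sum (I : eqType) (r : seq I) (F : I -> R -> R) (S : I -> bounded_op H) :
  {in r, forall i, is_cfc (F i) T (S i)} ->
  is_cfc (fun t => \sum_(i <- r) F i t) T (\sum_(i <- r) S i).
Proof.
elim: r => [|i r IH] FS.
  rewrite big_nil; have := is_cfc_cst 0; rewrite scale0r.
  by apply: eq_is_cfc => t _; rewrite big_nil.
rewrite big_cons.
have {}IH := IH (fun j jr => FS j (ltac:(by rewrite inE jr orbT))).
apply: eq_is_cfc (is_cfcD (FS i (mem_head i r)) IH) => t _.
by rewrite big_cons.
Qed.

Lemma is_cfc_sym f S : is_cfc f T S -> op_sym S.
Proof.
move=> [p [_ /cvg_rnormP pS]] x y; apply/eqP; rewrite -subr_eq0 -normr_le0.
apply/ler_addgt0Pr => e e0; rewrite add0r.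
pose N := rnorm x * rnorm y + 1.
have N0 : 0 < N by rewrite ltr_wpDl ?mulr_ge0 ?rnorm_nneg.
have [n _ Sn] := pS _ (divr_gt0 e0 (mulr_gt0 (ltr0Sn _ 1) N0)).
have {}Sn := Sn n (leqnn n).
set D := S - op_horner (p n) T in Sn.
have -> : rip (S x) y - rip x (S y) = rip (D x) y - rip (D y) x.
  rewrite /D /= !ripBl (op_sym_horner (p n) sT) (ripC (S y)) (ripC (op_horner _ _ y)).
  by ring.
have Dxy u v : rnorm u * rnorm v <= N -> `|rip (D u) v| <= e / 2.
  move=> uv; apply: le_trans (rip_op_le _ _ _) _.
  apply: (@le_trans _ _ (e / (2 * N) * N)).
    by apply: ler_pM; rewrite ?mulr_ge0 ?rnorm_nneg// ltW.
  by rewrite [leLHS](_ : _ = e / 2)//; field; rewrite gt_eqF.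
rewrite (le_trans (ler_normB _ _))// [leRHS]splitr lerD// Dxy//.
  by rewrite /N lerDl.
by rewrite mulrC /N lerDl.
Qed.

(** Multiplicativity of the calculus identifies the value at [1 / (t + l)] with the
    inverse of [T + l]. *)
Lemma is_cfc_resolvent (l : R) : 0 < l -> op_ge 0 T ->
  is_cfc (fun t => (t + l)^-1) T (op_inv (T + l%:C *: (1 : bounded_op H))).
Proof.
move=> l0 T0.
have KM t : rspectrum t -> 0 <= t <= rnorm T.
  by move=> Tt; rewrite (sym_spectrum_ge sT T0 Tt) (sym_spectrum_le sT Tt).
have rK := poly_approx_is_cfc (poly_approx_resolvent l0 KM).
set S := cfc _ T in rK.
have Tl := is_cfcD is_cfc_id (is_cfc_cst l).
have tl0 t : rspectrum t -> t + l != 0.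
  by move=> /KM /andP[t0 _]; rewrite gt_eqF// ltr_wpDl.
rewrite (@op_invE _ _ _ S)//.
  rewrite -[RHS](scale1r (1 : bounded_op H)) -[1 in RHS]/(1%:C).
  by apply: is_cfc_uniq (is_cfcM rK Tl) (is_cfc_cst 1) _ => t /tl0 ?; rewrite mulVf.
rewrite -[RHS](scale1r (1 : bounded_op H)) -[1 in RHS]/(1%:C).
by apply: is_cfc_uniq (is_cfcM Tl rK) (is_cfc_cst 1) _ => t /tl0 ?; rewrite mulfV.
Qed.

End ContinuousFunctionalCalculus.

(** * Square roots and the argument of the perspective *)

Section Perspective.
Context {R : realType} {H : hilbertType R}.
Implicit Types (A B C P S T : bounded_op H) (l : R).

(** The spectrum of a positive invertible operator lies in a compact subinterval of
    the open half-line. *)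
Lemma op_pos_cfc_approx (f : R -> R) T :
  (forall m M : R, 0 < m -> m <= M -> poly_approx `[m, M] f) ->
  op_pos T -> is_cfc f T (cfc f T).
Proof.
move=> fK posT; have sT := op_pos_sym posT; have [m m0 Tm] := op_pos_ge posT.
apply: poly_approx_is_cfc => // e e0.
have [p pf] := fK m (Num.max m (rnorm T)) m0 (ltac:(by rewrite le_max lexx)) e e0.
exists p => t Tt; apply: pf; rewrite /= in_itv /= (sym_spectrum_ge sT Tm Tt).
by rewrite le_max (sym_spectrum_le sT Tt) orbT.
Qed.

(** All identities hold between functions on the spectrum, where [t > 0], and are
    transported by uniqueness of the calculus. *)
Lemma op_pow_half P : op_pos P ->
  [/\ op_sym (op_pow 2^-1 P), op_sym (op_pow (- 2^-1) P),
      op_pow 2^-1 P * op_pow 2^-1 P = P,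
      op_pow 2^-1 P * op_pow (- 2^-1) P = 1 &
      op_pow (- 2^-1) P * op_pow 2^-1 P = 1].
Proof.
move=> posP; have sP := op_pos_sym posP; have [m m0 Pm] := op_pos_ge posP.
have t0 t : rspectrum P t -> 0 < t.
  by move=> Pt; apply: lt_le_trans m0 (sym_spectrum_ge sP Pm Pt).
have iP : is_cfc (fun t => t `^ (- 2^-1)) P (op_pow (- 2^-1) P).
  exact: op_pos_cfc_approx (@poly_approx_inv_sqrt R) posP.
have add1 (t : R) : 0 < t -> t * t `^ (- 2^-1) = t `^ 2^-1.
  move=> t00; rewrite -{1}(powRr1 (ltW t00)) -powRD ?(gt_eqF t00) ?implybT//.
  by congr (_ `^ _); field.
have hP : is_cfc (fun t => t `^ 2^-1) P (op_pow 2^-1 P).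
  have hP' := is_cfcM sP (is_cfc_id P) iP.
  have {}hP' : is_cfc (fun t => t `^ 2^-1) P (P * op_pow (- 2^-1) P).
    by apply: eq_is_cfc hP' => t /t0 /add1.
  by rewrite /op_pow (cfcE sP hP').
have one : is_cfc (fun t => t `^ 2^-1 * t `^ (- 2^-1)) P 1.
  have := is_cfc_cst P 1; rewrite -[1%:C]/(1 : R[i]) scale1r.
  apply: eq_is_cfc => t /t0 t00.
  by rewrite -powRD ?subrr ?powRr0// (gt_eqF t00) implybT.
split.
- exact: is_cfc_sym hP.
- exact: is_cfc_sym iP.
- apply: is_cfc_uniq (is_cfcM sP hP hP) (is_cfc_id P) _ => // t /t0 t00.
  rewrite -powRD ?(gt_eqF t00) ?implybT//.
  have -> : 2^-1 + 2^-1 = 1 :> R by field.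
  exact: powRr1 (ltW t00).
- exact: is_cfc_uniq (is_cfcM sP hP iP) one _.
- by apply: is_cfc_uniq (is_cfcM sP iP hP) one _ => // t _; rewrite mulrC.
Qed.

(** The argument of [f] in the perspective. *)
Definition op_ratio P B := op_pow (- 2^-1) P * B * op_pow (- 2^-1) P.

Lemma op_ratio_sym P B : op_pos P -> op_pos B -> op_sym (op_ratio P B).
Proof.
move=> /op_pow_half[_ sI _ _ _] posB; apply: op_sym_sandwich => //.
exact: op_pos_sym.
Qed.

Lemma op_ratio_ge P B : op_pos P -> op_pos B ->
  exists2 m : R, 0 < m & op_ge m (op_ratio P B).
Proof.
move=> posP posB; have [sS sI _ SI IS] := op_pow_half posP.
have Iinv : op_invertible (op_pow (- 2^-1) P) by exists (op_pow 2^-1 P).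
apply: sym_invertible_ge; first exact: op_ratio_sym.
  move=> x; rewrite mul0r [leRHS]sI.
  by apply: (@op_nneg_rip _ _ B (op_pow (- 2^-1) P x)); case: posB.
by apply: op_invertibleM => //; apply: op_invertibleM => //; case: posB.
Qed.

(** [t l / (t + l) = l - l^2 / (t + l)] evaluated at [C]. *)
Definition op_kernel l C : bounded_op H :=
  l%:C *: (1 : bounded_op H) - (l ^+ 2)%:C *: op_inv (C + l%:C *: (1 : bounded_op H)).

Lemma is_cfc_kernel l C : 0 < l -> op_sym C -> op_ge 0 C ->
  is_cfc (fun t => t * l / (t + l)) C (op_kernel l C).
Proof.
move=> l0 sC C0; have rC := is_cfc_resolvent sC l0 C0.
rewrite /op_kernel -scaleNr -rmorphN /=.
apply: eq_is_cfc (is_cfcD (is_cfc_cst _ l) (is_cfcZ sC (- l ^+ 2) rC)) => t Ct.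
have tl : 0 < t + l by rewrite ltr_wpDl// (sym_spectrum_ge sC C0 Ct).
by field; rewrite gt_eqF.
Qed.

(** [C + l] is [I (B + l P) I] with [I] the inverse of the square root [S] of [P], so its
    inverse is [S (B + l P)^-1 S]. *)
Lemma kernel_sandwich l P B : 0 < l -> op_pos P -> op_pos B ->
  op_pow 2^-1 P * op_kernel l (op_ratio P B) * op_pow 2^-1 P =
  l%:C *: P - (l ^+ 2)%:C *: (P * op_inv (B + l%:C *: P) * P).
Proof.
move=> l0 posP posB; have [sS sI SS SI IS] := op_pow_half posP.
have BlPinv : op_invertible (B + l%:C *: P).
  have [m m0 Bm] := op_pos_ge posB; apply: (op_ge_invertible m0).
    by apply: op_symD; [exact: op_pos_sym|apply: op_symZ; exact: op_pos_sym].
  move=> x; rewrite /= ripDl ripZl (le_trans (Bm x))// lerDl mulr_ge0 ?(ltW l0)//.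
  by apply: op_nneg_rip; case: posP.
have [UX XU] := op_invP BlPinv; set U := op_inv (B + _) in UX XU *.
set S := op_pow 2^-1 P in SS SI IS *; set I := op_pow (- 2^-1) P in SI IS.
have -> : op_kernel l (op_ratio P B)
    = l%:C *: (1 : bounded_op H) - (l ^+ 2)%:C *: (S * U * S).
  rewrite /op_kernel; congr (_ - _ *: _).
  have -> : op_ratio P B + l%:C *: (1 : bounded_op H) = I * (B + l%:C *: P) * I.
    have IPI : I * P * I = 1 by rewrite -[in I * P]SS mulrA IS mul1r SI.
    by rewrite mulrDr mulrDl -op_scalerAr -op_scalerAl IPI.
  apply: op_invE.
    by rewrite -!mulrA (mulrA S I) SI mul1r (mulrA U) UX mul1r SI.
  by rewrite -!mulrA (mulrA I S) IS mul1r (mulrA _ U) XU mul1r IS.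
rewrite mulrBr mulrBl -!op_scalerAr -!op_scalerAl mulr1 SS; congr (_ - _ *: _).
by rewrite !mulrA SS -!mulrA SS.
Qed.

End Perspective.

(** * Bochner integrals and scalar integrals *)

Section FiniteRange.
Context {R : realType} {d : measure_display} {T : measurableType d}.
Implicit Types (D : set T).

(** Simple functions with values in an arbitrary type. Pairs of simple functions, and
    their images by arbitrary maps, stay in this class, which replaces measurability
    of the norm and of the inner product. *)
Definition finite_levels (K : Type) (s : T -> K) :=
  finite_set (range s) /\ forall v, measurable (s @^-1` [set v]).

Lemma finite_levels_pair (K K' : Type) (s : T -> K) (s' : T -> K') :
  finite_levels s -> finite_levels s' -> finite_levels (fun x => (s x, s' x)).
Proof.
move=> [fs ms] [fs' ms']; split.
  apply: sub_finite_set (finite_setX fs fs') => _ [x _ <-] /=.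
  by split; exists x.
move=> [v v']; rewrite (_ : _ @^-1` _ = s @^-1` [set v] `&` s' @^-1` [set v']).
  exact: measurableI.
by apply/seteqP; split => x /=; [case=> -> ->|case=> -> ->].
Qed.

Lemma finite_levels_preimage (K : Type) (s : T -> K) (Y : set K) :
  finite_levels s -> measurable (s @^-1` Y).
Proof.
move=> [fs ms]; have -> : s @^-1` Y = \bigcup_(v in range s `&` Y) s @^-1` [set v].
  apply/seteqP; split => [x Yx|x [v [_ Yv] /= xv]]; last by rewrite /= xv.
  by exists (s x) => //; split => //; exists x.
by apply: fin_bigcup_measurable => // ; exact: sub_finite_set fs.
Qed.

Lemma finite_levels_comp (K K' : Type) (s : T -> K) (h : K -> K') :
  finite_levels s -> finite_levels (fun x => h (s x)).
Proof.
move=> fs; split; last by move=> v; exact: (finite_levels_preimage (h @^-1` [set v]) fs).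
have -> : range (fun x => h (s x)) = h @` range s by rewrite image_comp.
by case: fs => + _; exact: finite_image.
Qed.

Lemma measurable_finite_levels (K : Type) (s : T -> K) (h : K -> R) D :
  finite_levels s -> measurable_fun D (fun x => h (s x)).
Proof.
move=> fs mD Y mY; apply: measurableI => //.
exact: (finite_levels_preimage (h @^-1` Y) fs).
Qed.

Variables (mu : {measure set T -> \bar R}) (D : set T).
Hypothesis mD : measurable D.

(** Stated through a labelling [s] of finitely many measurable pieces rather than
    for a simple function: the label carries more information than the value,
    and distinct labels may have the same value. *)
Lemma integral_finite_levels (K : choiceType) (s : T -> K) (h : K -> R) :
  finite_levels s ->
  (forall v, h v != 0 -> (mu (D `&` s @^-1` [set v]) < +oo)%E) ->
  mu.-integrable D (fun x => (h (s x))%:E) /\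
  (\int[mu]_(x in D) (h (s x))%:E =
   (\sum_(v \in range s) fine (mu (D `&` s @^-1` [set v])) * h v)%:E)%E.
Proof.
move=> fs; have [fr ms] := fs.
have key (g : K -> R) : (forall v, g v != 0 -> (mu (D `&` s @^-1` [set v]) < +oo)%E) ->
    (\int[mu]_(x in D) (g (s x))%:E =
     (\sum_(v \in range s) fine (mu (D `&` s @^-1` [set v])) * g v)%:E)%E.
  move=> gfin; rewrite fsbig_finite//=.
  have DE : D = \big[setU/set0]_(v <- fset_set (range s)) (D `&` s @^-1` [set v]).
    rewrite -bigcup_seq; apply/seteqP; split => [x Dx|x [v _ []]//].
    by exists (s x) => //=; rewrite in_fset_set//; apply: mem_set; exists x.
  rewrite {1}DE integral_bigsetU_EFin.
  - rewrite -sumEFin; apply: eq_bigr => v _.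
    rewrite (eq_integral (cst (g v)%:E)); last first.
      by move=> x /set_mem[_ /= ->].
    rewrite integral_cst; last exact: measurableI.
    have [->|gv] := eqVneq (g v) 0; first by rewrite mul0e mulr0.
    rewrite muleC EFinM fineK// ge0_fin_numE ?measure_ge0//.
    exact: gfin.
  - by move=> v; exact: measurableI.
  - exact: fset_uniq.
  - move=> v v' _ _ [x [[_ /= xv] [_ /= xv']]]; by rewrite -xv -xv'.
  - rewrite -DE; apply/measurable_EFinP; exact: measurable_finite_levels.
move=> hfin; split; last exact: key.
apply/integrableP; split; first by apply/measurable_EFinP; exact: measurable_finite_levels.
rewrite (key (fun v => `|h v|)) ?ltry// => v; rewrite normr_eq0; exact: hfin.
Qed.

End FiniteRange.

Section WeakBochner.
Context {R : realType} {H : hilbertType R} {d : measure_display}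
  {T : measurableType d}.
Variables (mu : {measure set T -> \bar R}) (D : set T).
Hypothesis mD : measurable D.
Implicit Types (s g : T -> bounded_op H) (x y : H).

Lemma bochner_simple_levels s : bochner_simple mu D s -> finite_levels s.
Proof. by case. Qed.

Lemma rip_sum (I : Type) (r : seq I) (F : I -> bounded_op H) x y :
  rip ((\sum_(i <- r) F i) x) y = \sum_(i <- r) rip (F i x) y.
Proof.
elim: r => [|i r IH]; first by rewrite !big_nil rip0l.
by rewrite !big_cons /= ripDl IH.
Qed.

(** The integral of a simple function, a finite sum of operators, is determined by
    real Lebesgue integrals. *)
Lemma rip_simple_integral s x y : bochner_simple mu D s ->
  mu.-integrable D (fun t => (rip (s t x) y)%:E) /\
  (\int[mu]_(t in D) (rip (s t x) y)%:E = (rip (simple_integral mu D s x) y)%:E)%E.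
Proof.
move=> ss; have fs := bochner_simple_levels ss; have [fr _ sfin] := ss.
have [|ish hE] := integral_finite_levels mD (s := s)
  (h := fun S : bounded_op H => rip (S x) y) (mu := mu) fs.
  move=> v hv; apply: sfin; apply: contra_neq hv => ->.
  by rewrite /= rip0l.
split=> //; rewrite hE /simple_integral !fsbig_finite//= rip_sum.
by congr _%:E; apply: eq_bigr => v _; rewrite /= ripZl.
Qed.

Lemma cvg_rip (u : nat -> bounded_op H) (S : bounded_op H) x y : u n @[n --> \oo] --> S ->
  rip (u n x) y @[n --> \oo] --> rip (S x) y.
Proof.
move=> /cvg_rnormP uS; pose c := rnorm x * rnorm y + 1.
have c0 : 0 < c by rewrite ltr_wpDl ?mulr_ge0 ?rnorm_nneg.
apply/cvgrPdist_lt => e e0; apply: filterS (uS _ (divr_gt0 e0 c0)) => n.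
rewrite ltr_pdivlMr//; apply: le_lt_trans; rewrite -ripBl.
apply: le_trans (rip_op_le (S - u n) x y) _.
by rewrite ler_wpM2l ?rnorm_nneg// lerDl.
Qed.

(** Bochner integrability with convergence everywhere on [D]. The measure need not be
    complete, and with convergence almost everywhere [g] and its norm could fail to be
    measurable. *)
Definition strongly_approximable g := exists s_ : nat -> T -> bounded_op H,
  [/\ forall n, bochner_simple mu D (s_ n),
      forall t, D t -> s_ n t @[n --> \oo] --> g t &
      (\int[mu]_(t in D) (rnorm (g t - s_ n t))%:E)%E @[n --> \oo] --> 0%E].

Variable g : T -> bounded_op H.
Hypothesis gS : strongly_approximable g.

Lemma measurable_rnorm_sub s : finite_levels s ->
  measurable_fun D (fun t => rnorm (g t - s t)).
Proof.
move=> fs; have [s_ [ss sg _]] := gS.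
apply: (@measurable_fun_cvg _ _ _ D (fun n t => rnorm (s_ n t - s t))).
  move=> n; have fsn := bochner_simple_levels (ss n).
  exact: (measurable_finite_levels (fun p => rnorm (p.1 - p.2)) (finite_levels_pair fsn fs)).
move=> t Dt; have /cvg_rnormP sgt := sg t Dt; apply/cvgrPdist_lt => e e0.
apply: filterS (sgt e e0) => n; apply: le_lt_trans.
have := rnorm_add (g t - s_ n t) (s_ n t - s t).
have := rnorm_add (s_ n t - g t) (g t - s t).
rewrite !addrA !subrK (rnorm_sub (s_ n t) (g t)) ler_norml; lra.
Qed.

Lemma measurable_rip x y : measurable_fun D (fun t => rip (g t x) y).
Proof.
have [s_ [ss sg _]] := gS.
apply: (@measurable_fun_cvg _ _ _ D (fun n t => rip (s_ n t x) y)).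
  move=> n; exact: (measurable_finite_levels (fun S : bounded_op H => rip (S x) y)
    (bochner_simple_levels (ss n))).
by move=> t Dt; apply: cvg_rip; exact: sg.
Qed.

(** A bound that depends on [x] and [y] only through their norms: it will give
    convergence in operator norm. *)
Lemma rip_distance s x y : bochner_simple mu D s ->
  (\int[mu]_(t in D) (rnorm (g t - s t))%:E < +oo)%E ->
  (`|\int[mu]_(t in D) rip (g t x) y - rip (simple_integral mu D s x) y|%:E <=
   (rnorm x * rnorm y)%:E * \int[mu]_(t in D) (rnorm (g t - s t))%:E)%E.
Proof.
move=> ss gsfin; have fs := bochner_simple_levels ss.
have mgs := measurable_rnorm_sub fs; have mg := measurable_rip x y.
have ms : measurable_fun D (fun t => rip (s t x) y).
  exact: (measurable_finite_levels (fun S : bounded_op H => rip (S x) y) fs).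
have [is_ sE] := rip_simple_integral x y ss.
have c0 : 0 <= rnorm x * rnorm y by rewrite mulr_ge0 ?rnorm_nneg.
have bound t : `|rip (g t x) y - rip (s t x) y| <= rnorm x * rnorm y * rnorm (g t - s t).
  by rewrite -ripBl mulrC; exact: (rip_op_le (g t - s t) x y).
have igs : mu.-integrable D (fun t => (rnorm (g t - s t))%:E).
  apply/integrableP; split; first exact/measurable_EFinP.
  by under eq_integral do rewrite gee0_abs ?lee_fin ?rnorm_nneg//.
have idiff : mu.-integrable D (fun t => (rip (g t x) y - rip (s t x) y)%:E).
  apply: (le_integrable mD _ _ (integrableZl mD (rnorm x * rnorm y) igs)).
    by apply/measurable_EFinP; apply: measurable_funB.
  move=> t _; rewrite /= lee_fin [leRHS]ger0_norm//.
  by rewrite mulr_ge0 ?rnorm_nneg.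
have ig : mu.-integrable D (fun t => (rip (g t x) y)%:E).
  apply: eq_integrable (integrableD mD idiff is_) => // t _ /=.
  by rewrite -EFinD subrK.
have -> : (`|\int[mu]_(t in D) rip (g t x) y - rip (simple_integral mu D s x) y|%:E =
   `|\int[mu]_(t in D) (rip (g t x) y - rip (s t x) y)%:E|)%E.
  under [in RHS]eq_integral do rewrite EFinB.
  rewrite integralB_EFin// sE /Rintegral -abse_EFin EFinB fineK//.
  exact: integrable_fin_num.
apply: le_trans (le_abse_integral _ mD _) _; first by case/integrableP: idiff.
rewrite -ge0_integralZl_EFin//; last exact/measurable_EFinP.
apply: ge0_le_integral => //.
- by apply: measurableT_comp => //; apply/measurable_EFinP; exact: measurable_funB.
- by apply: measurable_funeM; exact/measurable_EFinP.
- by move=> t _; rewrite /= -EFinM lee_fin.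
- by move=> t _; rewrite lee_fin rnorm_nneg.
Qed.

End WeakBochner.

Section BochnerCharacterization.
Context {R : realType} {H : hilbertType R} {d : measure_display}
  {T : measurableType d}.
Variables (mu : {measure set T -> \bar R}) (D : set T).
Hypothesis mD : measurable D.
Implicit Types (g : T -> bounded_op H) (x y : H).

(** Both directions rest on [rip_distance]. For each [x] and [y] it makes the integrals of
    simple approximations converge to the scalar integral, which determines [v]; and as
    it is uniform in [x] and [y] of norm at most [1], these integrals converge in norm
    as soon as there is an operator [v] representing the scalar integrals. *)
Lemma is_bochnerP g (v : bounded_op H) : strongly_approximable mu D g ->
  is_bochner mu D g v <->
  (forall x y, \int[mu]_(t in D) rip (g t x) y = rip (v x) y).
Proof.
move=> gS.
have eventually_small (s_ : nat -> T -> bounded_op H) (e : R) : 0 < e ->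
    (\int[mu]_(t in D) (rnorm (g t - s_ n t))%:E)%E @[n --> \oo] --> 0%E ->
    \forall n \near \oo, (\int[mu]_(t in D) (rnorm (g t - s_ n t))%:E < e%:E)%E.
  by move=> e0 /fine_cvgP[fin /cvgrPdist_lt/(_ e e0) small]; near=> n;
    rewrite -[ltLHS]fineK; [rewrite lte_fin (le_lt_trans (ler_norm _))//
      -normrN -sub0r; near: n|near: n].
split=> [[s_ [ss _ sg sv]] x y|gv].
  apply/eqP; rewrite -subr_eq0 -normr_le0; apply/ler_addgt0Pr => e e0; rewrite add0r.
  pose c := rnorm x * rnorm y + 1.
  have c0 : 0 < c by rewrite ltr_wpDl ?mulr_ge0 ?rnorm_nneg.
  have e20 : 0 < e / 2 by exact: divr_gt0.
  have [n [Hn1 Hn2]] : exists n,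
      (\int[mu]_(t in D) (rnorm (g t - s_ n t))%:E < (e / 2 / c)%:E)%E /\
      `|rip (v x) y - rip (simple_integral mu D (s_ n) x) y| < e / 2.
    near \oo => n; exists n; split; near: n.
      by apply: eventually_small => //; exact: divr_gt0.
    by move: (@cvg_rip _ _ _ _ x y sv) => /cvgrPdist_lt; apply.
  have := rip_distance mD gS x y (ss n) (lt_trans Hn1 (ltry _)).
  set r := \int[mu]_(t in D) rip (g t x) y; set r' := rip (simple_integral mu D (s_ n) x) y.
  move=> rr'; have {}rr' : `|r - r'| <= e / 2.
    rewrite -lee_fin (le_trans rr')//.
    apply: (@le_trans _ _ (c%:E * (e / 2 / c)%:E)%E); last first.
      by rewrite -EFinM lee_fin mulrC divfK ?gt_eqF.
    apply: lee_pmul.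
    - by rewrite lee_fin mulr_ge0 ?rnorm_nneg.
    - by apply: integral_ge0 => t _; rewrite lee_fin rnorm_nneg.
    - by rewrite lee_fin lerDl.
    - exact: ltW.
  rewrite -(subrK r' r) -addrA (le_trans (ler_normD _ _))// [leRHS]splitr lerD//.
  by rewrite distrC ltW.
have [s_ [ss sg sg0]] := gS; exists s_; split => //.
  by apply: aeW.
apply/cvg_rnormP => e e0.
have e20 : 0 < e / 2 by exact: divr_gt0.
apply: filterS (eventually_small s_ _ e20 sg0) => n small.
apply: (@le_lt_trans _ _ (e / 2)); last by rewrite ltr_pdivrMr// ltr_pMr// ltr1n.
apply: rnorm_op_rip => [|x y]; first exact: ltW.
have := rip_distance mD gS x y (ss n) (lt_trans small (ltry _)).
rewrite gv -ripBl -lee_fin => /le_trans; apply.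
rewrite [e / 2 * _]mulrC [leRHS]EFinM; apply: lee_wpmul2l; last exact: ltW.
by rewrite lee_fin mulr_ge0 ?rnorm_nneg.
Unshelve. all: by end_near. Qed.

Lemma is_bochnerE g (v : bounded_op H) : strongly_approximable mu D g ->
  is_bochner mu D g v -> bochner mu D g = v.
Proof.
move=> gS gv; rewrite /bochner; case: xgetP => [v' _ gv'|/(_ v)//].
apply: op_eq_rip => x y.
by rewrite -((is_bochnerP v gS).1 gv) -((is_bochnerP v' gS).1 gv').
Qed.

Lemma eq_strongly_approximable g g' : (forall t, D t -> g t = g' t) ->
  strongly_approximable mu D g -> strongly_approximable mu D g'.
Proof.
move=> gg' [s_ [ss sg sg0]]; exists s_; split => //.
  by move=> t Dt; rewrite -gg'//; exact: sg.
rewrite (_ : (fun n => _) = (fun n => \int[mu]_(t in D) (rnorm (g t - s_ n t))%:E)%E)//.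
by apply/funext => n; apply: eq_integral => t /set_mem Dt; rewrite gg'.
Qed.

(** The definition sums over the values of [g o s]; here the sum is over the values of
    [s], at which [g] may repeat itself. *)
Lemma simple_integral_comp (s : T -> R) (g : R -> bounded_op H) : finite_levels s ->
  (forall u, g u != 0 -> (mu (D `&` s @^-1` [set u]) < +oo)%E) ->
  bochner_simple mu D (g \o s) /\
  simple_integral mu D (g \o s) =
  \sum_(u \in range s) (fine (mu (D `&` s @^-1` [set u])))%:C *: g u.
Proof.
move=> fs gfin; have [fr ms] := fs.
have [fgs mgs] := finite_levels_comp g fs.
have ss : bochner_simple mu D (g \o s).
  split=> // v v0.
  have [|iv vE] := integral_finite_levels (mu := mu) mD (h := fun u => (g u == v)%:R) fs.
    move=> y; rewrite pnatr_eq0 eqb0 negbK => /eqP gy.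
    by apply: gfin; rewrite gy.
  have mv : measurable ((g \o s) @^-1` [set v]) by exact: mgs.
  rewrite setIC -(integral_indic mu mD mv).
  rewrite (eq_integral (fun t => (g (s t) == v)%:R%:E)) ?vE ?ltry//.
split=> //; apply: op_eq_rip => x y.
apply: EFin_inj; have [_ <-] := rip_simple_integral mD x y ss.
have [|_ ->] := integral_finite_levels (mu := mu) mD (h := fun u => rip (g u x) y) fs.
  by move=> u gu; apply: gfin; apply: contra_neq gu => ->; rewrite /= rip0l.
rewrite !fsbig_finite//= rip_sum; congr _%:E.
by apply: eq_bigr => u _; rewrite /= ripZl.
Qed.

End BochnerCharacterization.

(** * Sampling a function on a finite-valued approximation of the identity *)

Section Grid.
Import HBNNSimple.
Context {R : realType}.
Notation RT := (measurableTypeR R).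
Variables (mu : {measure set RT -> \bar R}) (D : set RT).
Hypotheses (mD : measurable D) (D_ge0 : forall l : R, D l -> 0 <= l).

Lemma measurable_fun_EFin_id : measurable_fun D (fun l : RT => (l : R)%:E).
Proof. by apply/measurable_EFinP; exact: measurable_id. Qed.

(** Finite-valued measurable approximations of the identity from below: the value
    at [l] serves as the sampling point of the piece containing [l]. *)
Definition grid (n : nat) (l : RT) : R := nnsfun_approx mD measurable_fun_EFin_id n l.

Lemma grid_levels n : finite_levels (grid n).
Proof.
split; first exact: fimfunP.
by move=> v; apply: measurable_funPTI; exact: measurable_set1.
Qed.

Lemma grid_ge0 n l : 0 <= grid n l.
Proof. exact: fun_ge0. Qed.

Lemma grid_cvg l : D l -> grid n l @[n --> \oo] --> (l : R).
Proof.
move=> Dl; have f0 t : D t -> (0%:E <= (t : R)%:E)%E by move=> /D_ge0; rewrite lee_fin.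
have := cvg_nnsfun_approx mD measurable_fun_EFin_id f0 Dl.
by move=> /fine_cvgP[_]; exact.
Qed.

Lemma grid_le n l : D l -> grid n l <= l.
Proof.
move=> Dl; have gl := grid_cvg Dl; rewrite -[leRHS](cvg_lim _ gl)//.
apply: nondecreasing_cvgn_le; last by apply/cvg_ex; exists (l : R).
by move=> i j ij; have /lefP := nd_nnsfun_approx mD measurable_fun_EFin_id ij; exact.
Qed.

(** The piece where [grid n] is [u] lies to the right of [u]. *)
Lemma grid_mass n (u : R) :
  (0 <= u -> (mu (D `&` [set l : R | (u <= l)%R]) < +oo)%E) ->
  (mu (D `&` grid n @^-1` [set u]) < +oo)%E.
Proof.
move=> ufin; have mg := (grid_levels n).2 u.
have [u0|u0] := leP 0 u; last first.
  rewrite (_ : _ `&` _ = set0) ?measure0 ?ltry// -subset0 => l [_ /= gl].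
  by have := grid_ge0 n l; rewrite gl leNgt u0.
apply: le_lt_trans (ufin u0); apply: le_measure.
- by apply: mem_set; exact: measurableI.
- apply: mem_set; apply: measurableI => //.
  rewrite (_ : [set l' | _] = `[u, +oo[%classic); first exact: measurable_itv.
  by apply/seteqP; split => l /=; rewrite in_itv/= andbT.
- by move=> l [Dl /= <-]; split => //; exact: grid_le.
Qed.

Variable k : R -> R.
Hypotheses (mk : measurable_fun D (k : RT -> R)) (k_ge0 : forall l, D l -> 0 <= k l).
Hypothesis ik : mu.-integrable D (fun l : RT => (k l * l)%:E).

Lemma measurable_grid_defect n : measurable_fun D (fun l : RT => k l * (l - grid n l)).
Proof.
apply: measurable_funM => //; apply: measurable_funB; first exact: measurable_id.
exact: (measurable_finite_levels id (grid_levels n)).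
Qed.

Lemma grid_defect_ge0 n l : D l -> 0 <= k l * (l - grid n l).
Proof. by move=> Dl; rewrite mulr_ge0 ?k_ge0// subr_ge0 grid_le. Qed.

Lemma grid_defect_le n l : D l -> k l * (l - grid n l) <= k l * l.
Proof. by move=> Dl; rewrite ler_wpM2l ?k_ge0// gerBl grid_ge0. Qed.

Lemma integrable_grid_defect n :
  mu.-integrable D (fun l : RT => (k l * (l - grid n l))%:E).
Proof.
apply: (le_integrable mD _ _ ik).
  by apply/measurable_EFinP; exact: measurable_grid_defect.
move=> l Dl /=; rewrite lee_fin !ger0_norm ?grid_defect_ge0 ?grid_defect_le//.
by rewrite mulr_ge0 ?k_ge0 ?D_ge0.
Qed.

Lemma grid_defect_cvg0 l : D l -> k l * (l - grid n l) @[n --> \oo] --> (0 : R).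
Proof.
move=> Dl; have -> : (0 : R) = k l * (l - l) by rewrite subrr mulr0.
by apply: cvgM; [exact: cvg_cst|apply: cvgB; [exact: cvg_cst|exact: grid_cvg]].
Qed.

(** Dominated convergence, with majorant [k l * l]. *)
Lemma grid_defect_cvg :
  (\int[mu]_(l in D) (k l * (l - grid n l))%:E)%E @[n --> \oo] --> 0%E.
Proof.
have [|||||_ _] := @dominated_convergence _ _ _ mu D mD
  (fun n (l : RT) => (k l * (l - grid n l))%:E) (cst 0%E) (fun l : RT => (k l * l)%:E).
- by move=> n; apply/measurable_EFinP; exact: measurable_grid_defect.
- exact: measurable_cst.
- by apply: aeW => l Dl; apply/fine_cvgP; split; [exact: nearW|exact: grid_defect_cvg0].
- by [].
- apply: aeW => l n Dl; rewrite gee0_abs lee_fin ?grid_defect_ge0//.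
  exact: grid_defect_le.
- by rewrite integral0.
Qed.

Context {H : hilbertType R}.
Variable g : R -> bounded_op H.
Hypothesis g_lip : forall l l', D l -> 0 <= l' <= l -> rnorm (g l - g l') <= k l * (l - l').
Hypothesis g_fin : forall l : R, 0 <= l -> g l != 0 ->
  (mu (D `&` [set l' : R | (l <= l')%R]) < +oo)%E.

(** The measure may be infinite near [0], where [k] need not be integrable. As
    [0 <= grid n l <= l], it is enough that [k l * l] is. *)
Lemma grid_approximation : [/\ forall n, bochner_simple mu D (g \o grid n),
  forall l, D l -> g (grid n l) @[n --> \oo] --> g l &
  (\int[mu]_(l in D) (rnorm (g l - g (grid n l)))%:E)%E @[n --> \oo] --> 0%E].
Proof.
have ss n : bochner_simple mu D (g \o grid n).
  have [|] := @simple_integral_comp _ H _ _ mu D mD (grid n) g (grid_levels n); last by [].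
  by move=> u gu; apply: grid_mass => u0; exact: g_fin.
have lip n l : D l -> rnorm (g l - g (grid n l)) <= k l * (l - grid n l).
  by move=> Dl; apply: g_lip => //; rewrite grid_ge0 grid_le.
have cg l : D l -> g (grid n l) @[n --> \oo] --> g l.
  move=> Dl; apply/cvg_rnorm0.
  apply: (@squeeze_cvgr _ _ _ _ (fun=> 0) (fun n => k l * (l - grid n l))).
  - by apply: nearW => n; rewrite rnorm_nneg lip.
  - exact: cvg_cst.
  - exact: grid_defect_cvg0.
have mn n : measurable_fun D (fun l : RT => rnorm (g l - g (grid n l))).
  apply: (@measurable_fun_cvg _ _ _ D (fun m (l : RT) => rnorm (g (grid m l) - g (grid n l)))).
    move=> m; exact: (measurable_finite_levels (fun p => rnorm (g p.1 - g p.2))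
      (finite_levels_pair (grid_levels m) (grid_levels n))).
  move=> l Dl; have /cvg_rnormP cgl := cg l Dl; apply/cvgrPdist_lt => e e0.
  apply: filterS (cgl e e0) => m; apply: le_lt_trans.
  have := rnorm_add (g l - g (grid m l)) (g (grid m l) - g (grid n l)).
  have := rnorm_add (g (grid m l) - g l) (g l - g (grid n l)).
  rewrite !addrA !subrK (rnorm_sub (g (grid m l)) (g l)) ler_norml; lra.
have i0 : (\int[mu]_(l in D) (rnorm (g l - g (grid n l)))%:E)%E @[n --> \oo] --> 0%E.
  apply: (squeeze_cvge (f := fun=> 0%E)
    (h := fun n => \int[mu]_(l in D) (k l * (l - grid n l))%:E)%E).
  - apply: nearW => n; apply/andP; split.
      by apply: integral_ge0 => l _; rewrite lee_fin rnorm_nneg.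
    apply: ge0_le_integral => //.
    + by move=> l _; rewrite lee_fin rnorm_nneg.
    + by apply/measurable_EFinP; exact: mn.
    + by apply/measurable_EFinP; exact: measurable_grid_defect.
    + by move=> l Dl; rewrite lee_fin lip.
  - exact: cvg_cst.
  - exact: grid_defect_cvg.
by [].
Qed.

End Grid.

(** * The fundamental theorem of calculus for Bochner integrals *)

Section QuadraticFTC.
Context {R : realType}.
Notation leb := (@lebesgue_measure R).

Lemma within_itv_lipschitz (f : R -> R) (C : R) : 0 <= C ->
  (forall s t, 0 <= s <= 1 -> 0 <= t <= 1 -> `|f t - f s| <= C * `|t - s|) ->
  {within `[0, 1], continuous f}.
Proof.
move=> C0 fC; apply/subspace_continuousP => s /=; rewrite in_itv /= => s01.
apply/cvgrPdist_lt => e e0.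
have C1 : 0 < C + 1 by rewrite ltr_wpDl.
rewrite near_withinE; near=> t; rewrite /= in_itv /= => t01.
rewrite distrC; apply: le_lt_trans (fC _ _ s01 t01) _.
apply: (@le_lt_trans _ _ ((C + 1) * `|t - s|)); first by rewrite ler_wpM2r// lerDl.
rewrite mulrC -ltr_pdivlMr// distrC; near: t.
by apply: (@nbhsx_ballx _ R^o); rewrite divr_gt0.
Unshelve. all: by end_near. Qed.

(** A Taylor estimate of order two, uniform in both points, contains everything that
    the fundamental theorem of calculus needs: exchanging the two points and adding
    shows that the derivative is Lipschitz. *)
Lemma quadratic_lipschitz (V : normedModType R[i]) (F f : R -> V) (C : R) :
  (forall s t, 0 <= s <= 1 -> 0 <= t <= 1 ->
     rnorm (F t - F s - (t - s)%:C *: f s) <= C * (t - s) ^+ 2) ->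
  forall s t, 0 <= s <= 1 -> 0 <= t <= 1 -> rnorm (f t - f s) <= 2 * C * `|t - s|.
Proof.
move=> FC s t s01 t01; have [->|ts] := eqVneq t s.
  by rewrite subrr rnorm_zero subrr normr0 mulr0.
have ts0 : 0 < `|t - s| by rewrite normr_gt0 subr_eq0.
rewrite -(ler_pM2l ts0) -rnorm_scale.
have -> : (t - s)%:C *: (f t - f s) =
    (F t - F s - (t - s)%:C *: f s) + (F s - F t - (s - t)%:C *: f t).
  have -> : (s - t)%:C = - (t - s)%:C :> R[i] by rewrite -rmorphN opprB.
  by rewrite addrACA -[F s - F t]opprB subrr add0r scaleNr opprK scalerBr addrC.
apply: le_trans (rnorm_add _ _) _.
apply: le_trans (lerD (FC s t s01 t01) (FC t s t01 s01)) _.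
rewrite -[(t - s) ^+ 2]real_normK ?num_real// -[(s - t) ^+ 2]real_normK ?num_real//.
by rewrite (distrC s t) [leRHS](_ : _ = C * `|t - s| ^+ 2 + C * `|t - s| ^+ 2)//; ring.
Qed.

Lemma quadratic_FTC (F f : R -> R) (C : R) : 0 <= C ->
  (forall s t, 0 <= s <= 1 -> 0 <= t <= 1 ->
     `|F t - F s - (t - s) * f s| <= C * (t - s) ^+ 2) ->
  (forall s t, 0 <= s <= 1 -> 0 <= t <= 1 -> `|f t - f s| <= 2 * C * `|t - s|) ->
  \int[leb]_(t in `[0, 1]) f t = F 1 - F 0.
Proof.
move=> C0 FC flip.
have cf : {within `[0, 1], continuous f}.
  by apply: (within_itv_lipschitz (C := 2 * C)) => //; rewrite mulr_ge0.
have h0 : (0 : R) <= (0 : R) <= (1 : R) by rewrite ?lexx ?ler01.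
have h1 : (0 : R) <= (1 : R) <= (1 : R) by rewrite ?lexx ?ler01.
have cF : {within `[0, 1], continuous F}.
  apply: (within_itv_lipschitz (C := C + `|f 0| + 2 * C)) => [|s t s01 t01].
    by rewrite !addr_ge0 ?mulr_ge0.
  have fs : `|f s| <= `|f 0| + 2 * C.
    rewrite -[f s](subrK (f 0)) addrC (le_trans (ler_normD _ _))// lerD2l.
    apply: le_trans (flip 0 s h0 s01) _; rewrite subr0 ler_piMr ?mulr_ge0//.
    by case/andP: s01 => s0 s1; rewrite ger0_norm.
  have ts1 : `|t - s| <= 1.
    by rewrite ler_norml; case/andP: s01 => ? ?; case/andP: t01 => ? ?; apply/andP; split; lra.
  rewrite -[F t - F s](subrK ((t - s) * f s)) (le_trans (ler_normD _ _))//.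
  rewrite normrM -[C + `|f 0| + _]addrA [leRHS]mulrDl lerD//; last by rewrite mulrC ler_wpM2r.
  apply: le_trans (FC s t s01 t01) _; rewrite ler_wpM2l//.
  by rewrite -real_normK ?num_real// expr2 ler_piMl.
have dF s : s \in `]0, 1[%R -> is_derive (s : R^o) (1 : R^o) (F : R^o -> R^o) (f s).
  rewrite in_itv /= => /andP[s0 s1].
  have s01 : 0 <= s <= 1 by rewrite !ltW.
  have C1 : 0 < C + 1 by rewrite ltr_wpDl.
  have lim : (fun h : R^o => h^-1 *: ((F \o shift s) h - F s)) @ 0^' --> f s.
    apply/cvgrPdist_lt => e e0; near=> h.
    have h_neq0 : h != 0 by near: h; exact: nbhs_dnbhs_neq.
    have hs : 0 <= h + s <= 1.
      have : `|h| < Num.min s (1 - s).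
        near: h; apply: dnbhs0_lt; by rewrite lt_min s0 subr_gt0.
      rewrite lt_min !ltr_norml => /andP[/andP[h1' h2] /andP[h3 h4]]; apply/andP; split; lra.
    have he : `|h| < e / (C + 1) by near: h; apply: dnbhs0_lt; rewrite divr_gt0.
    have := FC s (h + s) s01 hs; rewrite addrK => Fh.
    have -> : f s - h^-1 *: ((F \o shift s) h - F s) = - (h^-1 * (F (h + s) - F s - h * f s)).
      by rewrite /= /GRing.scale /=; field.
    rewrite normrN normrM normfV ltr_pdivrMl ?normr_gt0//.
    apply: le_lt_trans Fh _; rewrite -real_normK ?num_real// expr2 mulrCA.
    rewrite ltr_pM2l ?normr_gt0//; apply: (@le_lt_trans _ _ ((C + 1) * `|h|)).
      by rewrite ler_wpM2r// lerDl.
    by rewrite mulrC -ltr_pdivlMr.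
  have {}lim : (fun h : R^o => h^-1 *: ((F \o shift s) (h *: (1 : R^o)) - F s)) @ 0^'
      --> f s.
    by under eq_fun do rewrite [_ *: (1 : R^o)]mulr1.
  by apply: DeriveDef; [apply/cvg_ex; exists (f s)|exact/cvg_lim].
have [_ F0 F1] := (continuous_within_itvP F (@ltr01 R)).1 cF.
rewrite /Rintegral (@continuous_FTC2 _ f F 0 1 ltr01 cf) //.
  split=> //; move=> s s01; have h := dF s s01; exact: ex_derive.
move=> s s01; have h := dF s s01; rewrite derive1E; exact: derive_val.
Unshelve. all: by end_near. Qed.

Context {H : hilbertType R}.

(** The Lipschitz bound makes [f] strongly approximable, and the scalar integrals of
    [<f x, y>] are given by the theorem for real functions. *)
Lemma bochner_quadratic_FTC (F f : R -> bounded_op H) (C : R) : 0 <= C ->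
  (forall s t, 0 <= s <= 1 -> 0 <= t <= 1 ->
     rnorm (F t - F s - (t - s)%:C *: f s) <= C * (t - s) ^+ 2) ->
  is_bochner leb `[0, 1] f (F 1 - F 0) /\ bochner leb `[0, 1] f = F 1 - F 0.
Proof.
move=> C0 FC; have flip := quadratic_lipschitz FC.
have leb01 : (leb `[0%R, 1%R]%classic < +oo)%E.
  by rewrite lebesgue_measure_itv /= lte_fin ltr01 -EFinB ltry.
have m01 : measurable (`[0, 1]%classic : set (measurableTypeR R)) by exact: measurable_itv.
have D_ge0 (l : R) : `[0, 1]%classic l -> 0 <= l by rewrite /= in_itv /= => /andP[].
have ik : leb.-integrable `[0, 1] (fun l : measurableTypeR R => (2 * C * (l : R))%:E).
  apply: continuous_compact_integrable; first exact: segment_compact.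
  by apply: continuous_subspaceT => l; apply: cvgM; [exact: cvg_cst|exact: cvg_id].
have [||l l'|l _ _|ss sg s0] := @grid_approximation _ leb `[0, 1] m01 D_ge0
  (fun=> 2 * C) _ _ ik H f.
- exact: measurable_cst.
- by move=> l _; rewrite mulr_ge0.
- rewrite /= in_itv /= => /andP[l0 l1] /andP[l'0 l'l].
  have := flip l' l; rewrite l'0 l0 l1 (le_trans l'l l1) => /(_ isT isT).
  by rewrite ger0_norm// subr_ge0.
- apply: le_lt_trans leb01; apply: le_measure; [apply: mem_set..|by move=> ? []].
    apply: measurableI => //.
    rewrite (_ : [set l' | _] = `[l, +oo[%classic); first exact: measurable_itv.
    by apply/seteqP; split => ? /=; rewrite in_itv/= andbT.
  exact: m01.
have fS : strongly_approximable leb `[0, 1] f by eexists; split; [exact: ss|exact: sg|exact: s0].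
suff fb : is_bochner leb `[0, 1] f (F 1 - F 0) by split=> //; exact: is_bochnerE fb.
apply/(is_bochnerP m01 _ fS) => x y.
rewrite /= ripBl; pose c := rnorm x * rnorm y.
have c0 : 0 <= c by rewrite mulr_ge0 ?rnorm_nneg.
apply: (quadratic_FTC (F := fun t => rip (F t x) y) (C := C * c)) => [|s t s01 t01|s t s01 t01].
- exact: mulr_ge0.
- rewrite -!ripZl -!ripBl.
  apply: le_trans (rip_op_le (F t - F s - (t - s)%:C *: f s) x y) _.
  by rewrite [leRHS]mulrAC ler_wpM2r ?FC.
- rewrite -ripBl; apply: le_trans (rip_op_le (f t - f s) x y) _.
  rewrite [leRHS](_ : _ = 2 * C * `|t - s| * c); last by ring.
  by rewrite ler_wpM2r ?flip.
Qed.

End QuadraticFTC.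

(** * The inner integral *)

Section InnerIntegral.
Context {R : realType} {H : hilbertType R}.
Implicit Types (A B P S T : bounded_op H).

(** [m |y|^2 <= <T y, y> <= |T y| |y|] at [y = T^-1 x]. *)
Lemma rnorm_op_inv T (m : R) : 0 < m -> op_ge m T -> op_invertible T ->
  rnorm (op_inv T) <= m^-1.
Proof.
move=> m0 Tm /op_invP[_ TV]; apply: rnorm_op_le => [|x]; first by rewrite invr_ge0 ltW.
set y := op_inv T x; have Ty : T y = x by rewrite -[LHS]/((T * op_inv T) x) TV.
rewrite mulrC ler_pdivlMr// mulrC.
have [->|y0] := eqVneq (rnorm y) 0; first by rewrite mulr0 rnorm_nneg.
have {}y0 : 0 < rnorm y by rewrite lt_def y0 rnorm_nneg.
rewrite -(ler_pM2r y0) -mulrA -expr2 (le_trans (Tm y))// Ty.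
exact: le_trans (ler_norm _) (rip_le x y).
Qed.

Lemma resolvent_identity S T : op_invertible S -> op_invertible T ->
  op_inv S - op_inv T = op_inv S * (T - S) * op_inv T.
Proof.
move=> /op_invP[SV _] /op_invP[_ TV].
by rewrite mulrBr mulrBl -mulrA TV mulr1 SV mul1r.
Qed.

Definition op_segment A B P (l t : R) : bounded_op H :=
  (1 - t)%:C *: A + t%:C *: B + l%:C *: P.

Lemma op_segment_invertible A B P (l m t : R) : 0 < m -> 0 < l ->
  op_sym A -> op_sym B -> op_pos P -> op_ge m A -> op_ge m B -> 0 <= t <= 1 ->
  op_ge m (op_segment A B P l t) /\ op_invertible (op_segment A B P l t).
Proof.
move=> m0 l0 sA sB posP Am Bm /andP[t0 t1].
have Xm : op_ge m (op_segment A B P l t).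
  move=> x; rewrite /op_segment /= !ripDl !ripZl.
  have P0 : 0 <= l * rip (P x) x.
    by rewrite mulr_ge0 ?(ltW l0)//; apply: op_nneg_rip; case: posP.
  have A0 : (1 - t) * (m * rnorm x ^+ 2) <= (1 - t) * rip (A x) x.
    by rewrite ler_wpM2l ?Am// subr_ge0.
  have B0 : t * (m * rnorm x ^+ 2) <= t * rip (B x) x by rewrite ler_wpM2l.
  lra.
split=> //; apply: (op_ge_invertible m0) => //.
by apply: op_symD; [apply: op_symD|]; apply: op_symZ => //; exact: op_pos_sym.
Qed.

Lemma op_segmentB A B P (l s t : R) :
  op_segment A B P l s - op_segment A B P l t = (s - t)%:C *: (B - A).
Proof.
rewrite /op_segment opprD addrACA subrr addr0 opprD addrACA -!scalerBl -!rmorphB /=.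
have -> : (1 - s - (1 - t))%:C = - (s - t)%:C :> R[i].
  by rewrite -rmorphN; congr (_%:C); ring.
by rewrite scaleNr addrC -scalerBr.
Qed.

(** The integrand is the derivative of [- P X(t)^-1 P] along the segment, by the
    resolvent identity used twice. *)
Lemma bochner_segment A B P (l : R) : 0 < l ->
  op_pos A -> op_pos B -> op_pos P ->
  let M t := op_inv (op_segment A B P l t) in
  let G t := P * M t * (B - A) * M t * P in
  let v := P * op_inv (A + l%:C *: P) * P - P * op_inv (B + l%:C *: P) * P in
  is_bochner lebesgue_measure `[0, 1] G v /\ bochner lebesgue_measure `[0, 1] G = v.
Proof.
move=> l0 posA posB posP M G v.
have [a a0 Aa] := op_pos_ge posA; have [b b0 Bb] := op_pos_ge posB.
pose m := Num.min a b; have m0 : 0 < m by rewrite lt_min a0.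
have Am : op_ge m A.
  by move=> x; apply: le_trans (Aa x); rewrite ler_wpM2r ?sqr_ge0// ge_min lexx.
have Bm : op_ge m B.
  by move=> x; apply: le_trans (Bb x); rewrite ler_wpM2r ?sqr_ge0// ge_min lexx orbT.
have segP t : 0 <= t <= 1 -> op_ge m (op_segment A B P l t) /\
    op_invertible (op_segment A B P l t).
  by apply: op_segment_invertible => //; exact: op_pos_sym.
have Mm t : 0 <= t <= 1 -> rnorm (M t) <= m^-1.
  by move=> /segP[Xm Xinv]; exact: rnorm_op_inv.
have MB s t : 0 <= s <= 1 -> 0 <= t <= 1 ->
    M t - M s = (s - t)%:C *: (M t * (B - A) * M s).
  move=> /segP[_ Xs] /segP[_ Xt]; rewrite resolvent_identity// op_segmentB.
  by rewrite -op_scalerAr -op_scalerAl.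
pose F t := - (P * M t * P).
pose D := rnorm (B - A).
have vE : v = F 1 - F 0.
  rewrite /v /F /M /op_segment opprK addrC subrr subr0 rmorph0 rmorph1 !scale0r !scale1r.
  by rewrite add0r addr0.
rewrite vE; apply: (@bochner_quadratic_FTC _ _ F G (rnorm P ^+ 2 * D ^+ 2 * m^-1 ^+ 3)).
  by rewrite !mulr_ge0 ?exprn_ge0 ?invr_ge0 ?rnorm_nneg ?(ltW m0).
move=> s t s01 t01.
have -> : F t - F s - (t - s)%:C *: G s =
    (- (t - s) ^+ 2)%:C *: (P * (M t * (B - A) * M s * (B - A) * M s) * P).
  have FB : F t - F s = (t - s)%:C *: (P * (M t * (B - A) * M s) * P).
    rewrite /F opprK addrC -mulrBl -mulrBr -[M s - M t]opprB MB//.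
    have -> : - ((s - t)%:C *: (M t * (B - A) * M s))
        = (t - s)%:C *: (M t * (B - A) * M s).
      by rewrite -scaleNr -rmorphN opprB.
    by rewrite -op_scalerAr -op_scalerAl.
  have GE : G s = P * (M s * (B - A) * M s) * P by rewrite /G !mulrA.
  rewrite FB GE -scalerBr -mulrBl -mulrBr -!mulrBl MB// -!op_scalerAl -op_scalerAr.
  rewrite -op_scalerAl scalerA -rmorphM; congr (_%:C *: _); ring.
rewrite rnorm_scale normrN ger0_norm ?sqr_ge0// mulrC ler_wpM2r ?sqr_ge0//.
have nM (S T : bounded_op H) (x y : R) : 0 <= x -> 0 <= y ->
    rnorm S <= x -> rnorm T <= y -> rnorm (S * T) <= x * y.
  by move=> x0 y0 Sx Ty; rewrite (le_trans (rnormM S T))// ler_pM ?rnorm_nneg.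
have mi : 0 <= m^-1 by rewrite invr_ge0 ltW.
apply: (@le_trans _ _ (rnorm P * (m^-1 * D * m^-1 * D * m^-1) * rnorm P)); last first.
  by rewrite [leLHS](_ : _ = rnorm P ^+ 2 * D ^+ 2 * m^-1 ^+ 3)//; ring.
by rewrite !nM ?mulr_ge0 ?rnorm_nneg ?Mm.
Qed.

End InnerIntegral.

(** * The outer integral *)

Section KernelEstimates.
Context {R : realType}.
Implicit Types (t l N : R).

(** The difference is [t^2 (l - l') / ((t + l) (t + l'))], where [t / (t + l') <= 1] and
    [t / (t + l) <= N / (1 + l)] as [N] bounds both [t] and [1]. *)
Lemma kernel_lipschitz t l l' N : 0 < t <= N -> 1 <= N -> 0 <= l' <= l ->
  `|t * l / (t + l) - t * l' / (t + l')| <= N / (1 + l) * (l - l').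
Proof.
move=> /andP[t0 tN] N1 /andP[l'0 l'l]; have l0 := le_trans l'0 l'l.
have tl : 0 < t + l by rewrite ltr_wpDr.
have tl' : 0 < t + l' by rewrite ltr_wpDr.
have ol : 0 < 1 + l by rewrite ltr_wpDr.
have -> : t * l / (t + l) - t * l' / (t + l')
    = (t / (t + l)) * (t / (t + l')) * (l - l').
  by field; rewrite !gt_eqF.
have ll : 0 <= l - l' by rewrite subr_ge0.
rewrite ger0_norm; last by rewrite !mulr_ge0 ?invr_ge0 ?(ltW t0) ?(ltW tl) ?(ltW tl').
rewrite ler_wpM2r// (@le_trans _ _ (t / (t + l)))//.
  by rewrite ler_piMr ?divr_ge0 ?(ltW t0) ?(ltW tl)// ler_pdivrMr// mul1r lerDl.
rewrite ler_pdivrMr// mulrAC ler_pdivlMr//.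
have : t * l <= N * l by rewrite ler_wpM2r.
have : t <= N * t by rewrite ler_peMl// ltW.
lra.
Qed.

Notation RT := (measurableTypeR R).
Variable w : {measure set RT -> \bar R}.
Notation D := (`]0, +oo[%classic : set RT).
Hypothesis w_fin : (\int[w]_(l in `]0%R, +oo[) (l / (1 + l))%:E < +oo)%E.

Lemma halfline_gt0 l : D l -> 0 < l.
Proof. by rewrite /= in_itv /= andbT. Qed.

Lemma measurable_halfline : measurable D.
Proof. exact: measurable_itv. Qed.

Lemma halfline_ge0 l : D l -> 0 <= l.
Proof. by move=> /halfline_gt0/ltW. Qed.

Lemma measurable_fun_kernel t N : 0 < t ->
  measurable_fun D (fun l : RT => N * l / (t + l)).
Proof.
move=> t0; apply: open_continuous_measurable_fun; first exact: interval_open.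
move=> l /set_mem /halfline_gt0 l0.
apply: cvgM; first by apply: cvgM; [exact: cvg_cst|exact: cvg_id].
apply: cvgV; first by rewrite gt_eqF// addr_gt0.
by apply: cvgD; [exact: cvg_cst|exact: cvg_id].
Qed.

Lemma measurable_fun_weight N : measurable_fun D (fun l : RT => N / (1 + l)).
Proof.
apply: open_continuous_measurable_fun; first exact: interval_open.
move=> l /set_mem /halfline_gt0 l0.
apply: cvgM; first exact: cvg_cst.
apply: cvgV; first by rewrite gt_eqF// addr_gt0.
by apply: cvgD; [exact: cvg_cst|exact: cvg_id].
Qed.

Lemma integrable_weight N : w.-integrable D (fun l : RT => (N / (1 + l) * l)%:E).
Proof.
have i1 : w.-integrable D (fun l : RT => (l / (1 + l))%:E).
  apply/integrableP; split.
    apply/measurable_EFinP; have := measurable_fun_kernel 1 (@ltr01 R).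
    by apply: eq_measurable_fun => l _; rewrite mul1r.
  rewrite (eq_integral (fun l : RT => (l / (1 + l))%:E))// => l /set_mem /halfline_gt0 l0.
  by rewrite gee0_abs// lee_fin divr_ge0// ?addr_ge0// ltW.
apply: eq_integrable (integrableZl measurable_halfline N i1) => //.
by move=> l _; rewrite -EFinM mulrAC mulrA.
Qed.

(** Markov's inequality for [l / (1 + l)], which is increasing. *)
Lemma halfline_tail_fin l : 0 < l ->
  (w (D `&` [set l' : R | (l <= l')%R]) < +oo)%E.
Proof.
move=> l0; have c0 : 0 < l / (1 + l) by rewrite divr_gt0// addr_gt0.
set E := _ `&` _.
have mE : measurable E.
  apply: measurableI; first exact: measurable_halfline.
  rewrite (_ : [set l' | _] = `[l, +oo[%classic); first exact: measurable_itv.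
  by apply/seteqP; split => ? /=; rewrite in_itv/= andbT.
have mf : measurable_fun D (fun l : RT => (l / (1 + l))%:E).
  apply/measurable_EFinP; have := measurable_fun_kernel 1 (@ltr01 R).
  by apply: eq_measurable_fun => u _; rewrite mul1r.
have f0 (u : RT) : D u -> (0 <= (u / (1 + u))%:E)%E.
  by move=> /halfline_gt0 u0; rewrite lee_fin divr_ge0// ?addr_ge0// ltW.
have ED : E `<=` D by move=> u [].
suff : ((l / (1 + l))%:E * w E < +oo)%E.
  have := measure_ge0 w E; case: (w E) => [r _ _| _|//]; first exact: ltry.
  by rewrite gt0_muley ?lte_fin.
apply: le_lt_trans w_fin.
apply: le_trans (ge0_subset_integral w mE measurable_halfline mf f0 ED).
rewrite -(integral_cst w mE); apply: ge0_le_integral => //.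
- by move=> u _; rewrite lee_fin ltW.
- exact: measurable_funS mf.
- move=> u [/halfline_gt0 u0 /= lu]; rewrite lee_fin ler_pdivrMr ?addr_gt0//.
  by rewrite mulrAC ler_pdivlMr ?addr_gt0//; lra.
Qed.

End KernelEstimates.

Section OuterIntegral.
Context {R : realType} {H : hilbertType R}.
Notation RT := (measurableTypeR R).
Variable w : {measure set RT -> \bar R}.
Notation D := (`]0, +oo[%classic : set RT).
Hypothesis w_fin : (\int[w]_(l in `]0%R, +oo[) (l / (1 + l))%:E < +oo)%E.
Variables (f : R -> R) (a b : R).
Hypothesis f_repr : forall t : R, 0 < t ->
  f t = a + b * t + \int[w]_(l in `]0, +oo[) (t * l / (t + l)).

Notation hgrid := (grid (@measurable_halfline R)).
Definition sample_mass n (u : R) : R := fine (w (D `&` hgrid n @^-1` [set u])).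
(** The error of sampling the kernel, for all [t] in [(0, N]] at once when [N >= 1]. *)
Definition sample_defect N n : R := fine (\int[w]_(l in D) (N / (1 + l) * (l - hgrid n l))%:E)%E.

Lemma defect_cvg N : 0 <= N -> sample_defect N n @[n --> \oo] --> (0 : R).
Proof.
move=> N0; have /fine_cvgP[_] := grid_defect_cvg (measurable_halfline (R := R))
  (@halfline_ge0 R) (measurable_fun_weight N)
  (fun l Dl => divr_ge0 N0 (addr_ge0 ler01 (halfline_ge0 Dl)))
  (integrable_weight w_fin N).
by [].
Qed.

(** Riemann-Stieltjes sums for the representation of [f], with an error that is
    uniform for [t] in [(0, N]]. *)
Lemma repr_sum_dist n (t N : R) : 0 < t <= N -> 1 <= N ->
  `|f t - (a + b * t + \sum_(u \in range (hgrid n)) sample_mass n u * (t * u / (t + u)))|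
    <= sample_defect N n.
Proof.
move=> tN N1; have [t0 _] := andP tN; have N0 : 0 <= N by exact: le_trans N1.
pose mD := measurable_halfline (R := R).
pose h (l : R) := t * l / (t + l).
have fl := grid_levels mD n.
have lip l : D l -> `|h l - h (hgrid n l)| <= N / (1 + l) * (l - hgrid n l).
  move=> Dl; apply: kernel_lipschitz => //.
  by rewrite grid_ge0 grid_le//; exact: halfline_ge0.
have k0 l : D l -> 0 <= N / (1 + l).
  by move=> Dl; rewrite divr_ge0// addr_ge0// (halfline_ge0 Dl).
have [u hu|ig gE] := integral_finite_levels (mu := w) mD (h := h) fl.
  apply: grid_mass => [l /halfline_ge0//|u0]; apply: halfline_tail_fin => //.
  by rewrite lt_def u0 andbT; apply: contra_neq hu => ->; rewrite /h mulr0 mul0r.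
have idef := integrable_grid_defect mD (@halfline_ge0 R) (measurable_fun_weight N) k0
  (integrable_weight w_fin N) n.
have mh : measurable_fun D (fun l : RT => h l) := measurable_fun_kernel t t0.
have ih : w.-integrable D (fun l : RT => (h l)%:E).
  apply: (le_integrable mD _ _ (integrable_weight w_fin N)); first exact/measurable_EFinP.
  move=> l Dl /=; rewrite lee_fin.
  have := kernel_lipschitz tN N1 (l := l) (l' := 0).
  rewrite lexx (halfline_ge0 Dl) => /(_ isT); rewrite mulr0 mul0r !subr0.
  by move=> /le_trans; apply; exact: ler_norm.
rewrite f_repr//.
have -> : \sum_(u \in range (hgrid n)) sample_mass n u * (t * u / (t + u)) =
    \int[w]_(l in D) h (hgrid n l) by rewrite /Rintegral gE.
rewrite opprD addrACA subrr add0r -(RintegralB mD ih ig).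
have idiff : w.-integrable D (fun l : RT => (h l - h (hgrid n l))%:E).
  by apply: eq_integrable (integrableB mD ih ig) => // l _; rewrite EFinB.
apply: le_trans (le_normr_Rintegral mD idiff) _.
rewrite /Rintegral /sample_defect; apply: fine_le.
- apply: integrable_fin_num => //; exact: (integrable_norm idiff).
- exact: integrable_fin_num.
- apply: ge0_le_integral => //.
  + by apply/measurable_EFinP; case/integrableP: (integrable_norm idiff) => /measurable_EFinP.
  + by apply/measurable_EFinP; case/integrableP: idef => /measurable_EFinP.
Qed.

Section Operator.
Variables (C : bounded_op H) (m : R).
Hypotheses (sC : op_sym C) (m0 : 0 < m) (Cm : op_ge m C).

Let N := Num.max 1 (rnorm C).

(** The value [0] is included because it may be a sampling point. *)
Lemma is_cfc_kernel_ge0 (l : R) : 0 <= l -> is_cfc (fun t => t * l / (t + l)) C (op_kernel l C).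
Proof.
rewrite le_eqVlt => /orP[/eqP <-|l0]; last first.
  apply: is_cfc_kernel => // x; apply: le_trans (Cm x).
  by rewrite ler_wpM2r ?sqr_ge0 ?ltW.
rewrite /op_kernel expr0n !scale0r subr0.
have := is_cfc_cst C 0; rewrite scale0r; apply: eq_is_cfc => t _.
by rewrite mulr0 mul0r.
Qed.

Lemma spectrum_range t : rspectrum C t -> 0 < t <= N.
Proof.
move=> Ct; rewrite (lt_le_trans m0 (sym_spectrum_ge sC Cm Ct)) /=.
by rewrite le_max (sym_spectrum_le sC Ct) orbT.
Qed.

Let N1 : 1 <= N. Proof. by rewrite le_max lexx. Qed.

Definition repr_sum n : bounded_op H := a%:C *: (1 : bounded_op H) + b%:C *: C +
  \sum_(u \in range (hgrid n)) (sample_mass n u)%:C *: op_kernel u C.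

Lemma is_cfc_repr_sum n : is_cfc (fun t => a + b * t +
  \sum_(u \in range (hgrid n)) sample_mass n u * (t * u / (t + u))) C (repr_sum n).
Proof.
have fr := (grid_levels (measurable_halfline (R := R)) n).1.
apply: is_cfcD.
  apply: is_cfcD; first exact: is_cfc_cst.
  by apply: is_cfcZ => //; exact: is_cfc_id.
rewrite fsbig_finite//; have := @is_cfc_sum _ _ C _ (fset_set (range (hgrid n)))
  (fun u t => sample_mass n u * (t * u / (t + u))) (fun u => (sample_mass n u)%:C *: op_kernel u C).
move=> sumP; apply: eq_is_cfc (sumP _) => [t _|u]; first by rewrite fsbig_finite.
rewrite in_fset_set// => /set_mem[l _ <-]; apply: is_cfcZ => //.
by apply: is_cfc_kernel_ge0; exact: grid_ge0.
Qed.

(** The sums of the representation are polynomially approximable, hence so is their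
    uniform limit [f]. *)
Lemma repr_is_cfc : is_cfc f C (cfc f C).
Proof.
apply: poly_approx_is_cfc => //; apply: poly_approx_lim => e e0.
have /cvgrPdist_lt/(_ e e0)[n _ dn] := defect_cvg (le_trans ler01 N1).
exists (fun t => a + b * t + \sum_(u \in range (hgrid n)) sample_mass n u * (t * u / (t + u))).
  exact: is_cfc_approx (is_cfc_repr_sum n).
move=> t Ct; rewrite distrC; apply: le_trans (repr_sum_dist n (spectrum_range Ct) N1) _.
have := dn n (leqnn n); rewrite /= sub0r normrN => /ltW; apply: le_trans.
exact: ler_norm.
Qed.

Lemma repr_sum_cvg : repr_sum n @[n --> \oo] --> cfc f C.
Proof.
apply/cvg_rnorm0.
apply: (squeeze_cvgr (f := fun=> 0) (h := sample_defect N)).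
- apply: nearW => n; rewrite rnorm_nneg /=.
  apply: (is_cfc_dist sC _ repr_is_cfc (is_cfc_repr_sum n)) => [|t Ct].
    apply: fine_ge0; apply: integral_ge0 => l Dl; have l0 := halfline_ge0 Dl.
    rewrite lee_fin; apply: mulr_ge0.
      by rewrite divr_ge0 ?addr_ge0 ?(le_trans ler01 N1).
    by rewrite subr_ge0; apply: grid_le => //; exact: halfline_ge0.
  exact: repr_sum_dist (spectrum_range Ct) N1.
- exact: cvg_cst.
- exact: defect_cvg (le_trans ler01 N1).
Qed.

Lemma kernel_op_lipschitz (l l' : R) : 0 <= l' <= l ->
  rnorm (op_kernel l C - op_kernel l' C) <= N / (1 + l) * (l - l').
Proof.
move=> /andP[l'0 l'l]; have l0 := le_trans l'0 l'l.
apply: (is_cfc_dist sC _ (is_cfc_kernel_ge0 l0) (is_cfc_kernel_ge0 l'0)) => [|t Ct].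
  rewrite mulr_ge0 ?subr_ge0// divr_ge0 ?addr_ge0//.
  exact: le_trans ler01 N1.
by apply: kernel_lipschitz (spectrum_range Ct) N1 _; rewrite l'0.
Qed.

End Operator.
End OuterIntegral.

Section PerspectiveIntegral.
Context {R : realType} {H : hilbertType R}.
Notation RT := (measurableTypeR R).
Variable w : {measure set RT -> \bar R}.
Notation D := (`]0, +oo[%classic : set RT).
Hypothesis w_fin : (\int[w]_(l in `]0%R, +oo[) (l / (1 + l))%:E < +oo)%E.
Variables (f : R -> R) (a b : R).
Hypothesis f_repr : forall t : R, 0 < t ->
  f t = a + b * t + \int[w]_(l in `]0, +oo[) (t * l / (t + l)).
Variables A B P : bounded_op H.
Hypotheses (posA : op_pos A) (posB : op_pos B) (posP : op_pos P).

Notation S := (op_pow 2^-1 P).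

Definition kernel_difference (l : R) : bounded_op H :=
  S * (op_kernel l (op_ratio P B) - op_kernel l (op_ratio P A)) * S.

Lemma kernel_differenceE l : 0 < l -> kernel_difference l =
  (l ^+ 2)%:C *: (P * op_inv (A + l%:C *: P) * P - P * op_inv (B + l%:C *: P) * P).
Proof.
move=> l0; rewrite /kernel_difference mulrBr mulrBl !kernel_sandwich//.
by rewrite opprB addrC addrA subrK scalerBr addrC.
Qed.

(** Sampled at the points of the grid, the integral of the kernel difference is
    [S (Sigma_B - Sigma_A) S - b (B - A)] with [Sigma_X] the finite sum that approximates
    [f(C X)], so it converges together with these sums. *)
Lemma bochner_kernel_difference :
  strongly_approximable w D kernel_difference /\
  is_bochner w D kernel_difference
    (perspective f B P - perspective f A P - b%:C *: (B - A)).
Proof.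
have [sS sI SS SI IS] := op_pow_half posP.
have sA := op_ratio_sym posP posA; have sB := op_ratio_sym posP posB.
have [mA mA0 CA] := op_ratio_ge posP posA; have [mB mB0 CB] := op_ratio_ge posP posB.
pose N C := Num.max 1 (rnorm (C : bounded_op H)).
have N0 C : 0 <= N C by rewrite (le_trans ler01)// le_max lexx.
pose K := rnorm S * (N (op_ratio P B) + N (op_ratio P A)) * rnorm S.
have K0 : 0 <= K by rewrite !mulr_ge0 ?rnorm_nneg// addr_ge0.
have k0 l : D l -> 0 <= K / (1 + l).
  by move=> /halfline_ge0 l0; rewrite divr_ge0// addr_ge0.
have lip l l' : D l -> 0 <= l' <= l ->
    rnorm (kernel_difference l - kernel_difference l') <= K / (1 + l) * (l - l').
  move=> /halfline_ge0 l0 ll'.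
  have llB := kernel_op_lipschitz sB mB0 CB ll'.
  have llA := kernel_op_lipschitz sA mA0 CA ll'.
  rewrite /kernel_difference -mulrBl -mulrBr.
  have -> : op_kernel l (op_ratio P B) - op_kernel l (op_ratio P A) -
      (op_kernel l' (op_ratio P B) - op_kernel l' (op_ratio P A)) =
      (op_kernel l (op_ratio P B) - op_kernel l' (op_ratio P B)) -
      (op_kernel l (op_ratio P A) - op_kernel l' (op_ratio P A)).
    by rewrite !opprB addrACA [RHS]addrACA; congr (_ + _); exact: addrC.
  rewrite (le_trans (rnormM _ _))//.
  have -> : K / (1 + l) * (l - l') = rnorm S * (N (op_ratio P B) / (1 + l) * (l - l') +
      N (op_ratio P A) / (1 + l) * (l - l')) * rnorm S.
    by rewrite /K; ring.
  rewrite ler_wpM2r ?rnorm_nneg// (le_trans (rnormM _ _))// ler_wpM2l ?rnorm_nneg//.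
  by rewrite (le_trans (rnorm_add _ _))// rnorm_opp lerD.
have nz0 (l : R) : kernel_difference l != 0 -> l != 0.
  apply: contra_neq => ->.
  by rewrite /kernel_difference /op_kernel expr0n !scale0r subrr mulr0 mul0r.
have gfin (l : R) : 0 <= l -> kernel_difference l != 0 ->
    (w (D `&` [set l' : R | (l <= l')%R]) < +oo)%E.
  by move=> l0 /nz0 ln0; apply: halfline_tail_fin => //; rewrite lt_def ln0.
have mD := measurable_halfline (R := R).
have [ss sg s0] := @grid_approximation _ w D (@measurable_halfline R) (@halfline_ge0 R)
  (fun l => K / (1 + l)) (measurable_fun_weight K) k0 (integrable_weight w_fin K)
  H kernel_difference lip gfin.
split; first by eexists; split; [exact: ss|exact: sg|exact: s0].
exists (fun n => kernel_difference \o grid (measurable_halfline (R := R)) n).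
split=> //; first exact: aeW.
have cB := repr_sum_cvg w_fin f_repr sB mB0 CB.
have cA := repr_sum_cvg w_fin f_repr sA mA0 CA.
have Sc : (fun _ : nat => S) n @[n --> \oo] --> S by exact: cvg_cst.
have ratioK X : S * op_ratio P X * S = X.
  by rewrite /op_ratio !mulrA SI mul1r -mulrA IS mulr1.
have lim := cvgB (op_cvgM (op_cvgM Sc (cvgB cB cA)) Sc) (cvg_cst (b%:C *: (B - A))).
have -> : perspective f B P - perspective f A P - b%:C *: (B - A) =
    S * (cfc f (op_ratio P B) - cfc f (op_ratio P A)) * S - b%:C *: (B - A).
  by rewrite mulrBr mulrBl.
rewrite (_ : (fun n => _) = (fun n => S * (repr_sum w a b (op_ratio P B) n -
   repr_sum w a b (op_ratio P A) n) * S - b%:C *: (B - A))); first exact: lim.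
apply/funext => n; have gl := grid_levels (@measurable_halfline R) n.
have [|_ ->] := @simple_integral_comp _ H _ _ w D mD _ kernel_difference gl.
  by move=> u gu; apply: grid_mass => [l /halfline_ge0//|u0]; exact: gfin.
have fr : finite_set _ := gl.1; rewrite /repr_sum !fsbig_finite//=.
set r := fset_set _.
have -> : a%:C *: (1 : bounded_op H) + b%:C *: op_ratio P B +
    \sum_(u <- r) (sample_mass w n u)%:C *: op_kernel u (op_ratio P B) -
    (a%:C *: (1 : bounded_op H) + b%:C *: op_ratio P A +
    \sum_(u <- r) (sample_mass w n u)%:C *: op_kernel u (op_ratio P A)) =
    b%:C *: (op_ratio P B - op_ratio P A) + \sum_(u <- r) (sample_mass w n u)%:C *:
      (op_kernel u (op_ratio P B) - op_kernel u (op_ratio P A)).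
  rewrite opprD addrACA; congr (_ + _).
    by rewrite opprD addrACA subrr add0r scalerBr.
  by rewrite -sumrB; apply: eq_bigr => u _; rewrite [RHS]scalerBr.
rewrite mulrDr mulrDl -op_scalerAr -op_scalerAl mulrBr mulrBl !ratioK addrC addrA addNr.
rewrite add0r mulr_sumr mulr_suml; apply: eq_bigr => u _.
by rewrite -op_scalerAr -op_scalerAl.
Qed.

End PerspectiveIntegral.

(** * The integral formula *)

Theorem theorem3 (R : realType) (H : hilbertType R) (f : R -> R) (a b : R)
    (w : {measure set (measurableTypeR R) -> \bar R})
    (f_mono : operator_monotone H f)
    (b_ge0 : 0 <= b)
    (w_fin : (\int[w]_(l in `]0%R, +oo[) (l / (1 + l))%:E < +oo)%E)
    (f_repr : forall t : R, 0 < t ->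
       f t = a + b * t + \int[w]_(l in `]0, +oo[) (t * l / (t + l)))
    (A B P : bounded_op H)
    (A_pos : op_pos A) (B_pos : op_pos B) (P_pos : op_pos P) :
  let M (l t : R) : bounded_op H :=
    op_inv ((1 - t)%:C *: A + t%:C *: B + l%:C *: P) in
  let G (l t : R) : bounded_op H := P * M l t * (B - A) * M l t * P in
  let F (l : R) : bounded_op H :=
    (l ^+ 2)%:C *: bochner lebesgue_measure `[0, 1] (G l) in
  [/\ forall l : R, 0 < l -> bochner_integrable lebesgue_measure `[0, 1] (G l),
      bochner_integrable w `]0, +oo[ F &
      perspective f B P - perspective f A P =
        b%:C *: (B - A) + bochner w `]0, +oo[ F].
Proof.
move=> M G F.
have FE l : (`]0, +oo[%classic : set (measurableTypeR R)) l -> kernel_difference A B P l = F l.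
  move=> /halfline_gt0 l0; rewrite kernel_differenceE// /F.
  by have [_ ->] := bochner_segment l0 A_pos B_pos P_pos.
have [kS kb] := bochner_kernel_difference w_fin f_repr A_pos B_pos P_pos.
have mD := measurable_halfline (R := R).
have FS := eq_strongly_approximable FE kS.
have Fb : is_bochner w `]0, +oo[ F
    (perspective f B P - perspective f A P - b%:C *: (B - A)).
  apply/(is_bochnerP mD _ FS) => x y; rewrite -((is_bochnerP mD _ kS).1 kb x y).
  by apply: eq_Rintegral => l /set_mem /FE ->.
split.
- by move=> l l0; have [Gb _] := bochner_segment l0 A_pos B_pos P_pos; eexists; exact: Gb.
- by eexists; exact: Fb.
- by rewrite (is_bochnerE mD FS Fb) [RHS]addrC subrK.
Qed.
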